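(* Let $\mathsf{G}_0,\mathsf{G}_1\in\mathcal{M}(\Omega,\mathbb{S}^n_+)$. Then $$\mathrm{WB}^2_\Lambda(\mathsf{G}_0,\mathsf{G}_1)=\inf_{\mathsf{G}\in\mathcal{AC}([0,1];\mathsf{G}_0,\mathsf{G}_1)}\mathcal{J}^\Lambda_{\mathsf{G}_0,\mathsf{G}_1}(\mathsf{G}),$$ and for every $\mathsf{G}\in\mathcal{AC}([0,1];\mathsf{G}_0,\mathsf{G}_1)$, $$\mathcal{J}^\Lambda_{\mathsf{G}_0,\mathsf{G}_1}(\mathsf{G})=\tfrac12\|(u_*,W_* )\|^2_{L^2_{\mathsf{G},\Lambda}(Q)},$$ where $(u_*,W_* )$ is the Riesz representation of $\widetilde{l}_{\mathsf{G}}$ in $H_{\mathsf{G},\Lambda}(\mathsf{D}^* )$, which is the unique solution of the minimum norm problem $$\inf\Big\{\tfrac12\|(u,W)\|^2_{L^2_{\mathsf{G},\Lambda}(Q)}:\ (u,W)\in L^2_{\mathsf{G},\Lambda}(Q,\mathbb{R}^{n\times k}\times\mathbb{M}^n),\ \big\langle(\mathsf{D}^*\Phi\,\Lambda_1^2,\Phi\Lambda_2^2),(u,W)\big\rangle_{L^2_{\mathsf{G},\Lambda}(Q)}=l_{\mathsf{G}}(\Phi)\ \ \forall\Phi\in C^1(Q,\mathbb{S}^n)\Big\}.$$ Moreover, $\mathcal{J}^\Lambda_{\mathsf{G}_0,\mathsf{G}_1}(\mathsf{G})$ admits the dual formulation $$\mathcal{J}^\Lambda_{\mathsf{G}_0,\mathsf{G}_1}(\mathsf{G})=\sup\Big\{l_{\mathsf{G}}(\Phi)-\tfrac12\|(\mathsf{D}^*\Phi\,\Lambda_1^2,\Phi\Lambda_2^2)\|^2_{L^2_{\mathsf{G},\Lambda}(Q)}:\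 \Phi\in C^1(Q,\mathbb{S}^n)\Big\}.$$
   Context: Matrices: $\mathbb{S}^n,\mathbb{S}^n_+,\mathbb{S}^n_{++}$ are the real symmetric, positive semidefinite, positive definite $n\times n$ matrices; $\mathbb{M}^n=\mathbb{R}^{n\times n}$; $A\cdot B=\mathrm{Tr}(A^{\mathrm T}B)$; $A^\dagger$ is the pseudoinverse; $\mathrm{Ran}$ is the range. $\mathcal{M}(\mathcal{X},V)$ denotes finite $V$-valued Radon measures on a compact metric space $\mathcal{X}$; $\langle\cdot,\cdot\rangle_{\mathcal{X}}$ is the duality pairing with continuous functions. Weights and action: fix positive integers $n,k,d$ and $\Lambda=(\Lambda_1,\Lambda_2)$ with $\Lambda_1\in\mathbb{S}^k_+$, $\Lambda_2\in\mathbb{S}^n_{++}$. Put $\mathbb{X}=\mathbb{S}^n\times\mathbb{R}^{n\times k}\times\mathbb{M}^n$. Define $J_\Lambda(X,Y,Z)=\frac12(Y\Lambda_1^\dagger)\cdot(X^\dagger Y\Lambda_1^\dagger)+\frac12(Z\Lambda_2^{-1})\cdot(X^\dagger Z\Lambda_2^{-1})$ if $X\in\mathbb{S}^n_+$, $\mathrm{Ran}(Y^{\mathrm T})\subset\mathrm{Ran}(\Lambda_1)$ and $\mathrm{Ran}([Y,Z])\subset\mathrm{Ran}(X)$, and $+\infty$ otherwise. For $\mu=(\mathsf{G},\mathsf{q},\mathsf{R})\in\mathcal{M}(\mathcal{X},\mathbb{X})$, $\mathcal{J}_{\Lambda,\mathcal{X}}(\mu)=\int_{\mathcal{X}}J_\Lambda(\frac{\mathrm{d}\mu}{\mathrm{d}\lambda})\,\mathrm{d}\lambda$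 for any nonnegative finite Radon $\lambda$ with $|\mu|\ll\lambda$ (independent of $\lambda$). Continuity equation: $\Omega\subset\mathbb{R}^d$ is compact with nonempty interior and smooth boundary; $Q=[0,1]\times\Omega$. $\mathsf{D}^*$ is a first-order constant-coefficient linear differential operator from $\mathbb{S}^n$-valued to $\mathbb{R}^{n\times k}$-valued functions on $\mathbb{R}^d$ with $\mathsf{D}^*(I)=0$; i.e. $\mathsf{D}^*\Phi=L_0(\Phi)+\sum_{j=1}^dL_j(\partial_{x_j}\Phi)$ with linear $L_j:\mathbb{S}^n\to\mathbb{R}^{n\times k}$ and $L_0(I)=0$; on functions of $(t,x)$ it acts in $x$. $C^1(Q,\mathbb{S}^n)$: derivatives exist in the interior and extend continuously to the boundary. $\Phi_t=\Phi(t,\cdot)$. $\mathcal{CE}([0,1];\mathsf{G}_0,\mathsf{G}_1)$ is the set of $\mu=(\mathsf{G},\mathsf{q},\mathsf{R})\in\mathcal{M}(Q,\mathbb{X})$ with $$\int_Q\partial_t\Phi\cdot\mathrm{d}\mathsf{G}+\mathsf{D}^*\Phi\cdot\mathrm{d}\mathsf{q}+\Phi\cdot\mathrm{d}\mathsf{R}=\int_\Omega\Phi_1\cdot\mathrm{d}\mathsf{G}_1-\int_\Omega\Phi_0\cdot\mathrm{d}\mathsf{G}_0\quad\forall\Phi\in C^1(Q,\mathbb{S}^n),$$ and $\mathcal{CE}_\infty([0,1];\mathsf{G}_0,\mathsf{G}_1)$ is the subset where $\mathcal{J}_{\Lambda,Q}(\mu)<\infty$. $\mathrm{WB}^2_\Lambda(\mathsf{G}_0,\mathsf{G}_1)=\inf\{\mathcal{J}_{\Lambda,Q}(\mu):\mu\in\mathcal{CE}([0,1];\mathsf{G}_0,\mathsf{G}_1)\}$.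 Function spaces: for $\mathsf{G}\in\mathcal{M}(Q,\mathbb{S}^n_+)$ with density $G_\lambda$ with respect to $\lambda$, $\langle P,P'\rangle_{L^2_{\mathsf{G}}(Q)}=\int_QP\cdot(G_\lambda P')\,\mathrm{d}\lambda$, and $$\langle(u,W),(u',W')\rangle_{L^2_{\mathsf{G},\Lambda}(Q)}=\langle u\Lambda_1^\dagger,u'\Lambda_1^\dagger\rangle_{L^2_{\mathsf{G}}(Q)}+\langle W\Lambda_2^{-1},W'\Lambda_2^{-1}\rangle_{L^2_{\mathsf{G}}(Q)}.$$ $L^2_{\mathsf{G},\Lambda}(Q,\mathbb{R}^{n\times k}\times\mathbb{M}^n)$ is the Hilbert space of measurable fields of finite seminorm modulo the kernel of the seminorm. $\mathcal{AC}([0,1];\mathsf{G}_0,\mathsf{G}_1)=\{\mathsf{G}\in\mathcal{M}(Q,\mathbb{S}^n):\exists(\mathsf{q},\mathsf{R})\in\mathcal{M}(Q,\mathbb{R}^{n\times k}\times\mathbb{M}^n)\text{ with }(\mathsf{G},\mathsf{q},\mathsf{R})\in\mathcal{CE}_\infty([0,1];\mathsf{G}_0,\mathsf{G}_1)\}$ (such $\mathsf{G}$ is automatically $\mathbb{S}^n_+$-valued), and $$\mathcal{J}^\Lambda_{\mathsf{G}_0,\mathsf{G}_1}(\mathsf{G})=\inf_{(\mathsf{q},\mathsf{R})}\Big\{\tfrac12\|(G^\dagger q,G^\dagger R)\|^2_{L^2_{\mathsf{G},\Lambda}(Q)}:(\mathsf{G},\mathsf{q},\mathsf{R})\in\mathcal{CE}_\infty([0,1];\mathsf{G}_0,\mathsf{G}_1)\Big\},$$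 where $G,q,R$ are densities with respect to a common reference measure; the quantity minimized equals $\mathcal{J}_{\Lambda,Q}((\mathsf{G},\mathsf{q},\mathsf{R}))$. $l_{\mathsf{G}}(\Phi)=\langle\mathsf{G}_1,\Phi_1\rangle_\Omega-\langle\mathsf{G}_0,\Phi_0\rangle_\Omega-\langle\mathsf{G},\partial_t\Phi\rangle_Q$ for $\Phi\in C^1(Q,\mathbb{S}^n)$. $\Pi(\Phi)=(\mathsf{D}^*\Phi\,\Lambda_1^2,\Phi\Lambda_2^2)$; $H_{\mathsf{G},\Lambda}(\mathsf{D}^* )$ is the closure of $\{\Pi(\Phi):\Phi\in C^1(Q,\mathbb{S}^n)\}$ in $L^2_{\mathsf{G},\Lambda}$; $\widetilde{l}_{\mathsf{G}}$ is the unique continuous extension to $H_{\mathsf{G},\Lambda}(\mathsf{D}^* )$ of $\Pi(\Phi)\mapsto l_{\mathsf{G}}(\Phi)$ (well defined for $\mathsf{G}\in\mathcal{AC}([0,1];\mathsf{G}_0,\mathsf{G}_1)$). *)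

(* Defs.v *)
From HB Require Import structures.
From mathcomp Require Import all_boot all_order all_algebra.
From mathcomp Require Import all_classical all_reals all_analysis.

Set Implicit Arguments.
Unset Strict Implicit.
Unset Printing Implicit Defensive.

Import Order.TTheory GRing.Theory Num.Theory.
Import numFieldNormedType.Exports.

Local Open Scope classical_set_scope.
Local Open Scope ring_scope.

Section matrices.
Context {R : realType}.

Definition mxdot m p (A B : 'M[R]_(m, p)) : R := \tr (A^T *m B).

Definition psdmx n (A : 'M[R]_n) : Prop :=
  A^T = A /\ forall x : 'cV[R]_n, 0 <= (x^T *m A *m x) 0 0.

Definition pdmx n (A : 'M[R]_n) : Prop :=
  A^T = A /\ forall x : 'cV[R]_n, x != 0 -> 0 < (x^T *m A *m x) 0 0.

(* MathComp's pinvmx is not the Moore-Penrose inverse. *)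
Definition penrose m p (A : 'M[R]_(m, p)) (B : 'M[R]_(p, m)) : Prop :=
  [/\ A *m B *m A = A, B *m A *m B = B,
      (A *m B)^T = A *m B & (B *m A)^T = B *m A].

Definition mpinv m p (A : 'M[R]_(m, p)) : 'M[R]_(p, m) :=
  xget 0 [set B | penrose A B].

(* Ran A `<=` Ran B for column spaces; (_ <= _)%MS compares row spaces. *)
Definition ran_sub m p q (A : 'M[R]_(m, p)) (B : 'M[R]_(m, q)) : Prop :=
  (A^T <= B^T)%MS.

Definition Jdensity n k (La1 : 'M[R]_k) (La2 : 'M[R]_n)
    (X : 'M[R]_n) (Y : 'M[R]_(n, k)) (Z : 'M[R]_n) : \bar R :=
  if `[< [/\ psdmx X, ran_sub Y^T La1 & ran_sub (row_mx Y Z) X] >] then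
    (2^-1 * mxdot (Y *m mpinv La1) (mpinv X *m Y *m mpinv La1)
     + 2^-1 * mxdot (Z *m invmx La2) (mpinv X *m Z *m invmx La2))%:E
  else +oo%E.

End matrices.

(* Finite signed Borel measures. On a compact subset of R^N every finite Borel
   measure is Radon; a measure on the compact set K is encoded as a measure on
   the ambient space that vanishes off K. *)
Definition borel (T : ptopologicalType) := g_sigma_algebraType (@open T).

Section charges.
Context d (T : measurableType d) {R : realType}.
Implicit Types nu : {charge set T -> \bar R}.

Definition hahn_pos nu : set T := projT1 (cid (Hahn_decomposition nu)).

Definition hahn_neg nu : set T :=
  projT1 (cid (projT2 (cid (Hahn_decomposition nu)))).

Definition hahnP nu : hahn_decomposition nu (hahn_pos nu) (hahn_neg nu) :=
  projT2 (cid (projT2 (cid (Hahn_decomposition nu)))).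

Definition cpairing (K : set T) (f : T -> R) nu : R :=
  (\int[jordan_pos (hahnP nu)]_(x in K) f x)%R
  - (\int[jordan_neg (hahnP nu)]_(x in K) f x)%R.

(* Sum of the total variation measures of a list of charges. *)
Definition sum_variation (s : seq ({charge set T -> \bar R})) :
    set T -> \bar R :=
  msum (fun i => charge_variation (hahnP (nth (czero : {charge set T -> \bar R}) s i)) :
    ({measure set T -> \bar R})) (size s).

HB.instance Definition _ s := Measure.on (sum_variation s).

Let sum_variation_fin s : fin_num_fun (sum_variation s).
Proof.
move=> A mA; rewrite /sum_variation /msum sum_fin_num; apply/allP => x.
by case/mapP => i _ ->; exact: fin_num_measure.
Qed.

HB.instance Definition _ s := @Measure_isFinite.Build _ _ _
  (sum_variation s) (@sum_variation_fin s).

End charges.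

HB.instance Definition _ (T U : ptopologicalType) := Pointed.on (T * U)%type.

Section mxmeasures.
Context {R : realType} {T : ptopologicalType}.

Definition mxmeas m p :=
  'I_m -> 'I_p -> {charge set (borel T) -> \bar R}.

Definition mxval m p (M : mxmeas m p) (A : set (borel T)) : 'M[R]_(m, p) :=
  \matrix_(i, j) fine (M i j A).

Definition concentrated (K : set T) m p (M : mxmeas m p) : Prop :=
  forall A : set (borel T), measurable A -> A `&` K = set0 -> mxval M A = 0.

Definition sym_valued n (M : mxmeas n n) : Prop :=
  forall A : set (borel T), measurable A -> (mxval M A)^T = mxval M A.

Definition psd_valued n (M : mxmeas n n) : Prop :=
  forall A : set (borel T), measurable A -> psdmx (mxval M A).

Definition pairing (K : set T) m p (F : T -> 'M[R]_(m, p))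
    (M : mxmeas m p) : R :=
  \sum_(i < m) \sum_(j < p) cpairing (K : set (borel T)) (fun x => F x i j)
    (M i j).

Definition entries m p (M : mxmeas m p) :
    seq ({charge set (borel T) -> \bar R}) :=
  [seq M ij.1 ij.2 | ij <- enum {: 'I_m * 'I_p}].

Definition density (la : {finite_measure set (borel T) -> \bar R}) m p
    (M : mxmeas m p) (x : T) : 'M[R]_(m, p) :=
  \matrix_(i, j) fine (Radon_Nikodym (M i j) la x).

(* Reference measures: both are equivalent to the total variation of the
   matrix-valued measure(s). *)
Definition ref1 n (G : mxmeas n n) : {finite_measure set (borel T) -> \bar R} :=
  sum_variation (entries G).

Definition ref3 n k (G : mxmeas n n) (q : mxmeas n k) (r : mxmeas n n) :
    {finite_measure set (borel T) -> \bar R} :=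
  sum_variation (entries G ++ entries q ++ entries r).

Definition Jaction n k (La1 : 'M[R]_k) (La2 : 'M[R]_n) (K : set T)
    (G : mxmeas n n) (q : mxmeas n k) (r : mxmeas n n) : \bar R :=
  let la := ref3 G q r in
  (\int[la]_(x in (K : set (borel T)))
     Jdensity La1 La2 (density la G x) (density la q x) (density la r x))%E.

End mxmeasures.
Arguments mxmeas R T m p : clear implicits.

(* The space L^2_{G,La}(K). Its elements are represented by measurable fields
   v = (u, W), and equality in it by L2norm _ _ _ _ (v - w) = 0. *)
Section weighted_L2.
Context {R : realType} {T : ptopologicalType} {n k : nat}.

Definition vfield := T -> 'M[R]_(n, k) * 'M[R]_n.

Definition L2ip0 (K : set T) (G : mxmeas R T n n) m
    (P P' : T -> 'M[R]_(n, m)) : \bar R :=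
  (\int[ref1 G]_(x in (K : set (borel T)))
     (mxdot (P x) (density (ref1 G) G x *m P' x))%:E)%E.

Variables (La1 : 'M[R]_k) (La2 : 'M[R]_n) (K : set T) (G : mxmeas R T n n).

Definition L2ip (v w : vfield) : \bar R :=
  (L2ip0 K G (fun x => ((v x).1 *m mpinv La1)) (fun x => (w x).1 *m mpinv La1)
   + L2ip0 K G (fun x => (v x).2 *m invmx La2)
               (fun x => (w x).2 *m invmx La2))%E.

Definition L2norm2 (v : vfield) : \bar R := L2ip v v.

Definition L2norm (v : vfield) : \bar R := sqrte (L2norm2 v).

Definition subf (v w : vfield) : vfield := fun x => v x - w x.

Definition L2mem (v : vfield) : Prop :=
  [/\ forall i j, measurable_fun (K : set (borel T)) (fun x => (v x).1 i j),
      forall i j, measurable_fun (K : set (borel T)) (fun x => (v x).2 i j)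
    & (L2norm2 v < +oo)%E].

End weighted_L2.
Arguments vfield R T n k : clear implicits.

Section space_time.
Context {R : realType} {d : nat}.

Fixpoint Ck (m : nat) (f : 'rV[R]_d -> R) : Prop :=
  match m with
  | 0 => continuous f
  | m'.+1 => forall v : 'rV[R]_d,
      (forall x, derivable f x v) /\ Ck m' (fun x => 'D_v f x)
  end.

(* Near each boundary point, Omega is a regular sublevel set of a smooth
   function. *)
Definition smooth_boundary (Omega : set 'rV[R]_d) : Prop :=
  forall x, closure Omega x -> ~ interior Omega x ->
    exists phi : 'rV[R]_d -> R,
      [/\ forall m, Ck m phi, phi x = 0,
          exists v : 'rV[R]_d, 'D_v phi x != 0
        & \forall y \near x, Omega y <-> phi y <= 0].

Definition spacetime (Omega : set 'rV[R]_d) : set (R * 'rV[R]_d) :=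
  `[0, 1] `*` Omega.

(* C^1(Q, S^n): the fields C1dt and C1dx are the continuous extensions to Q of
   the partial derivatives in the interior; values off Q are irrelevant. *)
Record C1fun (n : nat) (Q : set (R * 'rV[R]_d)) := MkC1 {
  C1f :> R * 'rV[R]_d -> 'M[R]_n;
  C1dt : R * 'rV[R]_d -> 'M[R]_n;
  C1dx : 'I_d -> R * 'rV[R]_d -> 'M[R]_n;
  C1_sym : forall z, Q z -> (C1f z)^T = C1f z;
  C1_cont : {within Q, continuous C1f};
  C1dt_cont : {within Q, continuous C1dt};
  C1dx_cont : forall j, {within Q, continuous (C1dx j)};
  C1dtP : forall z, interior Q z ->
    is_derive z ((1, 0) : R * 'rV[R]_d) C1f (C1dt z);
  C1dxP : forall j z, interior Q z ->
    is_derive z ((0, delta_mx 0 j) : R * 'rV[R]_d) C1f (C1dx j z) }.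

(* First-order operators. A linear map on S^n is given by any linear map on all
   n x n matrices extending it; on a
   constant function A the operator is op0 A. *)
Record diffop (n k : nat) := MkDiffop {
  op0 : {linear 'M[R]_n -> 'M[R]_(n, k)};
  op1 : 'I_d -> {linear 'M[R]_n -> 'M[R]_(n, k)} }.

Definition diffop_app n k (D : diffop n k) Q (Phi : C1fun n Q)
    (z : R * 'rV[R]_d) : 'M[R]_(n, k) :=
  op0 D (Phi z) + \sum_(j < d) op1 D j (C1dx Phi j z).

End space_time.
Arguments diffop R d n k : clear implicits.

Section transport.
Context {R : realType} {d n k : nat}.
Variables (La1 : 'M[R]_k) (La2 : 'M[R]_n) (Omega : set 'rV[R]_d).
Variables (D : diffop R d n k) (G0 G1 : mxmeas R 'rV[R]_d n n).

Let X := (R * 'rV[R]_d)%type.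
Let Q : set (R * 'rV[R]_d) := spacetime Omega.

Definition CE (G : mxmeas R X n n) (q : mxmeas R X n k)
    (r : mxmeas R X n n) : Prop :=
  [/\ concentrated Q G /\ sym_valued G, concentrated Q q, concentrated Q r &
    forall Phi : C1fun n Q,
      pairing Q (C1dt Phi) G + pairing Q (diffop_app D Phi) q + pairing Q Phi r
      = pairing Omega (fun x => Phi (1, x)) G1
        - pairing Omega (fun x => Phi (0, x)) G0].

Definition CEoo (G : mxmeas R X n n) (q : mxmeas R X n k)
    (r : mxmeas R X n n) : Prop :=
  CE G q r /\ (Jaction La1 La2 Q G q r < +oo)%E.

Definition WB2 : \bar R :=
  ereal_inf [set c | exists G q r, CE G q r /\ c = Jaction La1 La2 Q G q r].

Definition ACset (G : mxmeas R X n n) : Prop := exists q r, CEoo G q r.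

(* The vfield (G^dagger q, G^dagger R). *)
Definition velocity (G : mxmeas R X n n) (q : mxmeas R X n k)
    (r : mxmeas R X n n) : vfield R X n k :=
  let la := ref3 G q r in
  fun x => (mpinv (density la G x) *m density la q x,
            mpinv (density la G x) *m density la r x).

Definition Jcost (G : mxmeas R X n n) : \bar R :=
  ereal_inf [set c | exists q r, CEoo G q r /\
    c = (2^-1%:E * L2norm2 La1 La2 Q G (velocity G q r))%E].

Definition lform (G : mxmeas R X n n) (Phi : C1fun n Q) : R :=
  pairing Omega (fun x => Phi (1, x)) G1
  - pairing Omega (fun x => Phi (0, x)) G0
  - pairing Q (C1dt Phi) G.

Definition PiD (Phi : C1fun n Q) : vfield R X n k :=
  fun z => (diffop_app D Phi z *m (La1 *m La1), Phi z *m (La2 *m La2)).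

Definition Hspace (G : mxmeas R X n n) (v : vfield R X n k) : Prop :=
  L2mem La1 La2 Q G v /\
  forall e : R, 0 < e ->
    exists Phi : C1fun n Q, (L2norm La1 La2 Q G (subf v (PiD Phi)) < e%:E)%E.

Definition continuous_extension (G : mxmeas R X n n)
    (l : vfield R X n k -> R) : Prop :=
  (forall Phi : C1fun n Q, l (PiD Phi) = lform G Phi) /\
  forall v, Hspace G v -> forall e : R, 0 < e -> exists2 dl : R, 0 < dl &
    forall w, Hspace G w -> (L2norm La1 La2 Q G (subf w v) < dl%:E)%E ->
      `|l w - l v| < e.

Definition riesz_rep (G : mxmeas R X n n) (l : vfield R X n k -> R)
    (v : vfield R X n k) : Prop :=
  Hspace G v /\
  forall w, Hspace G w -> (l w)%:E = L2ip La1 La2 Q G w v.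

Definition feasible (G : mxmeas R X n n) (v : vfield R X n k) : Prop :=
  L2mem La1 La2 Q G v /\
  forall Phi : C1fun n Q, L2ip La1 La2 Q G (PiD Phi) v = (lform G Phi)%:E.

Definition min_norm_solution (G : mxmeas R X n n) (v : vfield R X n k) : Prop :=
  feasible G v /\
  (2^-1%:E * L2norm2 La1 La2 Q G v)%E =
    ereal_inf [set (2^-1%:E * L2norm2 La1 La2 Q G w)%E | w in feasible G].

Definition Jdual (G : mxmeas R X n n) : \bar R :=
  ereal_sup [set ((lform G Phi)%:E
                  - 2^-1%:E * L2norm2 La1 La2 Q G (PiD Phi))%E
            | Phi in [set: C1fun n Q]].

End transport.

(* Main.v *)
(** A competitor (G, q, R) of finite action has q = G u and R = G W almost
    everywhere for the velocity (u, W) = (G^+ q, G^+ R), and its action is half the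
    squared norm of (u, W) in L^2_{G,La}. Pairing the momenta with a test function
    Phi gives the inner product of Pi(Phi) = (D* Phi La1^2, Phi La2^2) with (u, W),
    so the continuity equation says that this inner product is l_G(Phi).
    Conversely every field (u, W) with these inner products produces momenta
    G u La1^+ La1 and G W with the same action. Hence the cost of G is a minimum
    norm problem over an affine subspace of L^2_{G,La}, solved by the orthogonal
    projection onto the closure of the fields Pi(Phi); the dual formula completes
    the square. The projection needs L^2_{G,La} to be complete, which is proved
    from the measurability of the Moore-Penrose inverse. *)

Require Import Defs.
From mathcomp Require Import all_boot all_order all_algebra.
From mathcomp Require Import all_classical all_reals all_analysis.
From mathcomp Require Import measurable_realfun ring lra.

Set Implicit Arguments.
Unset Strict Implicit.
Unset Printing Implicit Defensive.

Import Order.TTheory GRing.Theory Num.Theory.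
Import numFieldNormedType.Exports.

Local Open Scope classical_set_scope.
Local Open Scope ring_scope.

(** * Matrices *)

Section matrix_dot.
Context {R : realType}.

(** Two reference measures meet: the norm of L^2_{G,La} integrates against [ref1 G], the action of a
    competitor against [ref3 G q r], which may charge sets that [ref1 G] ignores. Finite action
    excludes momentum where G vanishes, and since the action density is homogeneous of degree one,
    the density h of the first measure with respect to the second carries every identity from one to
    the other. The other obstacle is degeneracy. G and La1 may be singular, so distinct fields can
    be at distance zero. No quotient is formed: the Hilbert space argument is run for a positive
    semidefinite form on the fields singled out by a predicate, and uniqueness means distance zero.
    A field is then pinned down only through its product with the density of G, and its first
    component only up to the projection onto the range of La1; limits, momenta and integrability are
    all handled at that level. *)

Lemma mxdotE m p (A B : 'M[R]_(m, p)) :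
  mxdot A B = \sum_i \sum_j A i j * B i j.
Proof.
rewrite /mxdot /mxtrace exchange_big; apply: eq_bigr => j _ /=.
by rewrite mxE; apply: eq_bigr => i _; rewrite mxE.
Qed.

Lemma mxdotC m p (A B : 'M[R]_(m, p)) : mxdot A B = mxdot B A.
Proof.
by rewrite !mxdotE; apply: eq_bigr => i _; apply: eq_bigr => j _; rewrite mulrC.
Qed.

Lemma mxdotDr m p (A B C : 'M[R]_(m, p)) :
  mxdot A (B + C) = mxdot A B + mxdot A C.
Proof. by rewrite /mxdot mulmxDr mxtraceD. Qed.

Lemma mxdotZr m p c (A B : 'M[R]_(m, p)) : mxdot A (c *: B) = c * mxdot A B.
Proof. by rewrite /mxdot -scalemxAr mxtraceZ. Qed.

Lemma mxdotDl m p (A B C : 'M[R]_(m, p)) :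
  mxdot (B + C) A = mxdot B A + mxdot C A.
Proof. by rewrite mxdotC mxdotDr !(mxdotC A). Qed.

Lemma mxdotZl m p c (A B : 'M[R]_(m, p)) : mxdot (c *: A) B = c * mxdot A B.
Proof. by rewrite mxdotC mxdotZr mxdotC. Qed.

Lemma mxdotNN m p (A B : 'M[R]_(m, p)) : mxdot (- A) (- B) = mxdot A B.
Proof. by rewrite -(scaleN1r A) -(scaleN1r B) mxdotZl mxdotZr mulrA mulrNN !mul1r. Qed.

Lemma mxdot_mulr m p q (A : 'M[R]_(m, q)) (B : 'M[R]_(m, p)) (C : 'M[R]_(p, q)) :
  mxdot A (B *m C) = mxdot (A *m C^T) B.
Proof. by rewrite /mxdot trmx_mul trmxK mulmxA mxtrace_mulC mulmxA. Qed.

Lemma mxdot_mull m p q (A : 'M[R]_(m, q)) (B : 'M[R]_(p, q)) (C : 'M[R]_(m, p)) :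
  mxdot A (C *m B) = mxdot (C^T *m A) B.
Proof. by rewrite /mxdot trmx_mul trmxK mulmxA. Qed.

Lemma mxdot_deltal m p (A : 'M[R]_(m, p)) i j :
  mxdot (delta_mx i j) A = A i j.
Proof.
rewrite mxdotE (bigD1 i) //= (bigD1 j) //= mxE !eqxx mul1r.
rewrite [X in _ + X + _]big1 => [|l /negPf jl]; last by rewrite mxE jl andbF mul0r.
rewrite addr0 big1 ?addr0// => l /negPf il.
by apply: big1 => ? _; rewrite mxE il mul0r.
Qed.

Lemma mxdot_col m p (A B : 'M[R]_(m, p)) :
  mxdot A B = \sum_j ((col j A)^T *m col j B) 0 0.
Proof.
rewrite mxdotE exchange_big; apply: eq_bigr => j _ /=.
by rewrite mxE; apply: eq_bigr => i _; rewrite !mxE.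
Qed.

Lemma mxdot_ge0 m p (A : 'M[R]_(m, p)) : 0 <= mxdot A A.
Proof.
rewrite mxdotE; apply: sumr_ge0 => i _; apply: sumr_ge0 => j _.
by rewrite -expr2 sqr_ge0.
Qed.

Lemma mxdot_eq0 m p (A : 'M[R]_(m, p)) : mxdot A A = 0 -> A = 0.
Proof.
move=> /eqP; rewrite mxdotE psumr_eq0 => [/allP A0|i _]; last first.
  by apply: sumr_ge0 => j _; rewrite -expr2 sqr_ge0.
apply/matrixP => i j; rewrite mxE.
have := A0 i (mem_index_enum _); rewrite psumr_eq0 => [/allP/(_ j)|l _].
  by rewrite mem_index_enum => /(_ isT) /=; rewrite mulf_eq0 orbb => /eqP.
by rewrite -expr2 sqr_ge0.
Qed.

(** Discriminant of a nonnegative quadratic polynomial in t; Cauchy-Schwarz and the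
    near-orthogonality of minimizing sequences are both instances. *)
Lemma sqr_le_of_quadratic (a b c : R) : 0 <= c ->
  (forall t, 0 <= a + 2 * t * b + t ^+ 2 * c) -> b ^+ 2 <= a * c.
Proof.
move=> c0 H; have [c_eq0|c_neq0] := eqVneq c 0.
  subst c; rewrite mulr0; have [->|b0] := eqVneq b 0; first by rewrite expr0n.
  (* For c = 0 the polynomial is affine, and this t gives it the value -1. *)
  have := H (- (a + 1) / (2 * b)).
  have -> : a + 2 * (- (a + 1) / (2 * b)) * b
      + (- (a + 1) / (2 * b)) ^+ 2 * 0 = -1 by field.
  by lra.
have c_gt0 : 0 < c by rewrite lt_def c_neq0.
have := H (- b / c).
have -> : a + 2 * (- b / c) * b + (- b / c) ^+ 2 * c = (a * c - b ^+ 2) / c.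
  by field.
by rewrite pmulr_lge0 ?invr_gt0// subr_ge0.
Qed.

Section psd.
Context n (X : 'M[R]_n) (Xpsd : psdmx X).

Lemma psdmx_mxdot_sym m (V W : 'M[R]_(n, m)) :
  mxdot V (X *m W) = mxdot W (X *m V).
Proof. by rewrite mxdot_mull mxdotC (proj1 Xpsd). Qed.

Lemma psdmx_mxdot_ge0 m (V : 'M[R]_(n, m)) : 0 <= mxdot V (X *m V).
Proof.
rewrite mxdot_col; apply: sumr_ge0 => j _.
have -> : col j (X *m V) = X *m col j V by rewrite !colE mulmxA.
by rewrite mulmxA; exact: (proj2 Xpsd).
Qed.

Lemma psdmx_mxdot_expand m (V W : 'M[R]_(n, m)) t :
  mxdot (V + t *: W) (X *m (V + t *: W)) =
  mxdot V (X *m V) + 2 * t * mxdot V (X *m W) + t ^+ 2 * mxdot W (X *m W).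
Proof.
rewrite mulmxDr -scalemxAr !(mxdotDr, mxdotDl) !(mxdotZl, mxdotZr).
rewrite (psdmx_mxdot_sym W V); ring.
Qed.

Lemma psdmx_cauchy_schwarz m (V W : 'M[R]_(n, m)) :
  mxdot V (X *m W) ^+ 2 <= mxdot V (X *m V) * mxdot W (X *m W).
Proof.
apply: sqr_le_of_quadratic => [|t]; first exact: psdmx_mxdot_ge0.
by rewrite -psdmx_mxdot_expand psdmx_mxdot_ge0.
Qed.

(** Cauchy-Schwarz against a matrix unit: the seminorm of V bounds the entries of X V, though not
    those of V when X is singular. *)
Lemma psdmx_entry_sqr m (V : 'M[R]_(n, m)) i j :
  ((X *m V) i j) ^+ 2 <= X i i * mxdot V (X *m V).
Proof.
rewrite -(mxdot_deltal (X *m V)).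
apply: le_trans (psdmx_cauchy_schwarz _ _) _.
have -> // : mxdot (delta_mx i j) (X *m delta_mx i j) = X i i.
rewrite mxdot_deltal mxE (bigD1 i) //= big1 => [|l /negPf li].
  by rewrite mxE !eqxx mulr1 addr0.
by rewrite mxE li mulr0.
Qed.

Lemma psdmx_diag_ge0 i : 0 <= X i i.
Proof.
have := psdmx_mxdot_ge0 (delta_mx i ord0 : 'M[R]_(n, 1)).
rewrite mxdot_deltal mxE (bigD1 i) //= big1 => [|l /negPf li].
  by rewrite mxE !eqxx mulr1 addr0.
by rewrite mxE li mulr0.
Qed.

Lemma psdmxZ (c : R) : 0 <= c -> psdmx (c *: X).
Proof.
case: Xpsd => symX X0 c0; split; first by rewrite linearZ /= symX.
by move=> x; rewrite -scalemxAr -scalemxAl mxE mulr_ge0.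
Qed.

End psd.

Lemma psdmx0 n : psdmx (0 : 'M[R]_n).
Proof. by split=> [|x]; rewrite ?trmx0// mulmx0 mul0mx mxE. Qed.

End matrix_dot.

(** * Existence and uniqueness of the Moore-Penrose inverse *)

Section moore_penrose.
Context {R : realType}.

Lemma unitmx_gram r p (F : 'M[R]_(r, p)) : row_free F -> F *m F^T \in unitmx.
Proof.
move=> freeF; rewrite -row_free_unit -kermx_eq0; apply/eqP/row_matrixP => i.
rewrite row0; set x := row i _.
have x0 : x *m (F *m F^T) = 0.
  by apply/sub_kermxP; exact: row_sub.
have : mxdot (x *m F)^T (x *m F)^T = 0.
  by rewrite /mxdot trmxK trmx_mul mulmxA -(mulmxA x) x0 mul0mx mxtrace0.
move=> /mxdot_eq0/(congr1 trmx); rewrite trmxK trmx0 => xF0.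
by apply/eqP; rewrite -(mulmx_free_eq0 x freeF) xF0.
Qed.

(** Full rank makes both Gram matrices invertible, and the witness is MacDuffee's formula F^T (F
    F^T)^-1 (C^T C)^-1 C^T. *)
Lemma penrose_full_rank m r p (C : 'M[R]_(m, r)) (F : 'M[R]_(r, p)) :
  row_free C^T -> row_free F -> exists B, penrose (C *m F) B.
Proof.
move=> freeC freeF; have uF : F *m F^T \in unitmx by exact: unitmx_gram.
have uC : C^T *m C \in unitmx by rewrite -[X in _ *m X]trmxK; exact: unitmx_gram.
pose IF := invmx (F *m F^T); pose IC := invmx (C^T *m C).
have symIF : IF^T = IF by rewrite /IF trmx_inv trmx_mul trmxK.
have symIC : IC^T = IC by rewrite /IC trmx_inv trmx_mul trmxK.
have IFK : (F *m F^T) *m IF = 1%:M by exact: mulmxV.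
have KIF : IF *m (F *m F^T) = 1%:M by exact: mulVmx.
have KIC : IC *m (C^T *m C) = 1%:M by exact: mulVmx.
exists (F^T *m IF *m IC *m C^T).
have AB : C *m F *m (F^T *m IF *m IC *m C^T) = C *m IC *m C^T.
  by rewrite !mulmxA -(mulmxA C F) -(mulmxA C) IFK mulmx1.
have BA : F^T *m IF *m IC *m C^T *m (C *m F) = F^T *m IF *m F.
  by rewrite !mulmxA -(mulmxA _ C^T C) -(mulmxA _ IC) KIC mulmx1.
split.
- by rewrite AB !mulmxA -(mulmxA _ C^T C) -(mulmxA _ IC) KIC mulmx1.
- by rewrite BA !mulmxA -(mulmxA _ F F^T) -(mulmxA F^T IF) KIF mulmx1.
- by rewrite AB !trmx_mul trmxK symIC mulmxA.
- by rewrite BA !trmx_mul trmxK symIF mulmxA.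
Qed.

Lemma penrose_exists m p (A : 'M[R]_(m, p)) : exists B, penrose A B.
Proof.
rewrite -(mulmx_base A); apply: penrose_full_rank; last exact: row_base_free.
by rewrite /row_free mxrank_tr; exact: col_base_full.
Qed.

Lemma mpinvP m p (A : 'M[R]_(m, p)) : penrose A (mpinv A).
Proof.
rewrite /mpinv; have [B AB] := penrose_exists A.
exact: (@xgetPex _ 0 [set B | penrose A B]) (ex_intro _ B AB).
Qed.

(** The product of the symmetric matrices A B and A C is A C in this order and A B in the other, so
    transposition identifies them; likewise B A and C A. *)
Lemma penrose_unique m p (A : 'M[R]_(m, p)) B C :
  penrose A B -> penrose A C -> B = C.
Proof.
move=> [ABA BAB AB BA] [ACA CAC AC CA].
have ABC : A *m B = A *m C.
  transitivity ((A *m B *m (A *m C))^T); last by rewrite mulmxA ABA AC.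
  by rewrite trmx_mul AB AC mulmxA ACA.
have BAC : B *m A = C *m A.
  transitivity ((C *m A *m (B *m A))^T); last by rewrite -mulmxA (mulmxA A) ABA CA.
  by rewrite trmx_mul BA CA -mulmxA (mulmxA A) ACA.
by rewrite -BAB -mulmxA ABC mulmxA BAC CAC.
Qed.

Lemma mpinv_tr m p (A : 'M[R]_(m, p)) : mpinv A^T = (mpinv A)^T.
Proof.
apply: (penrose_unique (mpinvP _)); have [ABA BAB AB BA] := mpinvP A.
split; rewrite -!trmx_mul ?mulmxA ?ABA ?BAB//; first by rewrite BA.
by rewrite AB.
Qed.

Lemma mul_mpinv_ran n m (X : 'M[R]_n) (Y : 'M[R]_(n, m)) :
  ran_sub Y X -> X *m mpinv X *m Y = Y.
Proof.
rewrite /ran_sub => /submxP[C] /(congr1 trmx); rewrite trmx_mul !trmxK => ->.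
by rewrite !mulmxA; have [->] := mpinvP X.
Qed.

Lemma ran_sub_mulmx n m p (X : 'M[R]_(n, p)) (Y : 'M[R]_(p, m)) : ran_sub (X *m Y) X.
Proof. by rewrite /ran_sub trmx_mul submxMl. Qed.

Lemma ran_sub_row_mx n m p q (X : 'M[R]_(n, p)) (Y : 'M[R]_(n, m)) (Z : 'M[R]_(n, q)) :
  ran_sub (row_mx Y Z) X <-> ran_sub Y X /\ ran_sub Z X.
Proof.
rewrite /ran_sub tr_row_mx col_mx_sub; split=> [/andP//|[-> ->]//].
Qed.

Section symmetric.
Context n (X : 'M[R]_n) (symX : X^T = X).

Lemma mpinv_sym : (mpinv X)^T = mpinv X.
Proof. by rewrite -mpinv_tr symX. Qed.

Lemma mpinv_comm : mpinv X *m X = X *m mpinv X.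
Proof.
have [_ _ _ XX] := mpinvP X.
by rewrite -XX trmx_mul symX mpinv_sym.
Qed.

End symmetric.

End moore_penrose.

(** * Regularized inverses and their limit *)

Section mpinv_limit.
Context {R : realType}.

(* Rational in the entries of A for each e > 0, and convergent to the
   Moore-Penrose inverse as e -> 0: this makes mpinv Borel measurable, although
   it is discontinuous. *)
Definition tikhonov m p (A : 'M[R]_(m, p)) (e : R) : 'M[R]_(p, m) :=
  invmx (A^T *m A + e%:M) *m A^T.

Lemma tikhonov_unit m p (A : 'M[R]_(m, p)) (e : R) : 0 < e ->
  A^T *m A + e%:M \in unitmx.
Proof.
move=> e0; rewrite -row_free_unit -kermx_eq0; apply/eqP/row_matrixP => i.
rewrite row0; set x := row i _.
have x0 : x *m (A^T *m A + e%:M) = 0 by apply/sub_kermxP; exact: row_sub.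
have : mxdot x (x *m (A^T *m A + e%:M)) = 0 by rewrite x0 /mxdot mulmx0 mxtrace0.
rewrite mulmxDr mxdotDr mul_mx_scalar mxdotZr mulmxA mxdot_mulr.
move=> /eqP; rewrite paddr_eq0 ?mulr_ge0 ?mxdot_ge0 ?(ltW e0)// => /andP[_].
by rewrite mulf_eq0 (gt_eqF e0) /= => /eqP/mxdot_eq0.
Qed.

(** Expanding |A - B|^2 >= 0 yields |A| <= |B| without square roots. *)
Lemma mxdot_le_trans m p (A B : 'M[R]_(m, p)) :
  mxdot A A <= mxdot A B -> mxdot A A <= mxdot B B.
Proof.
have : 0 <= mxdot (A + (-1) *: B) (A + (-1) *: B) by exact: mxdot_ge0.
by rewrite !(mxdotDl, mxdotDr) !(mxdotZl, mxdotZr) (mxdotC B A); lra.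
Qed.

(** With S = A^T A and B the inverse of A, A^T = S B and (S + e)^-1 S = 1 - e (S + e)^-1, so the
    error is - e (S + e)^-1 B. As B = S E lies in the range of S, the factor e is not consumed by (S
    + e)^-1 and the error is O(e). *)
Lemma tikhonov_bound m p (A : 'M[R]_(m, p)) :
  exists K : R, forall e, 0 < e ->
    forall i j, `|(tikhonov A e - mpinv A) i j| <= e * K.
Proof.
set B := mpinv A; have [ABA BAB AB BA] := mpinvP A; rewrite -/B in ABA BAB AB BA.
pose S := A^T *m A; pose E := B *m B^T *m B.
have AtE : A^T = S *m B.
  by rewrite /S -mulmxA -AB -trmx_mul ABA.
have BE : B = S *m E by rewrite -{1}BAB -BA trmx_mul AtE /E !mulmxA.
exists (2 * (1 + mxdot E E)) => e e0 i j.
set M := S + e%:M; have uM : M \in unitmx by exact: tikhonov_unit.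
have SE : S = M - e%:M by rewrite addrK.
pose Y := e *: (invmx M *m E).
have -> : tikhonov A e - B = - (e *: (E - Y)).
  have MS : invmx M *m S = 1%:M - e *: invmx M.
    by rewrite SE mulmxBr mulVmx// mul_mx_scalar.
  rewrite /tikhonov -/S -/M AtE mulmxA MS mulmxBl mul1mx addrAC subrr add0r.
  by rewrite [in LHS]BE -scalemxAl mulmxA MS mulmxBl mul1mx -scalemxAl.
(* Test (S + e) Y = e E against Y and drop the nonnegative term Y . S Y. *)
have YY : mxdot Y Y <= mxdot E E.
  have MY : M *m Y = e *: E by rewrite /Y -scalemxAr mulmxA mulmxV// mul1mx.
  have : e * mxdot Y Y <= e * mxdot Y E.
    rewrite -[leRHS]mxdotZr -MY mulmxDl mxdotDr mul_scalar_mx mxdotZr lerDr.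
    by rewrite /S -mulmxA mxdot_mull trmxK mxdot_ge0.
  by rewrite ler_pM2l//; exact: mxdot_le_trans.
(* The inequality t <= 1 + t^2 bounds an entry by the squared norm without a root, whence the
   constant 2 (1 + |E|^2). *)
have entry (Z : 'M[R]_(p, m)) : `|Z i j| <= 1 + mxdot Z Z.
  have : Z i j ^+ 2 <= mxdot Z Z.
    rewrite mxdotE (bigD1 i)//= (bigD1 j)//= -expr2 -addrA lerDl addr_ge0//.
      by apply: sumr_ge0 => l _; rewrite -expr2 sqr_ge0.
    by apply: sumr_ge0 => k _; apply: sumr_ge0 => l _; rewrite -expr2 sqr_ge0.
  have : `|Z i j| <= 1 + `|Z i j| ^+ 2 by nra.
  by rewrite real_normK ?num_real//; lra.
have entryB (Z W : 'M[R]_(p, m)) : mxdot W W <= mxdot Z Z ->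
    `|(- (e *: (Z - W))) i j| <= e * (2 * (1 + mxdot Z Z)).
  move=> WZ; rewrite !mxE normrN normrM gtr0_norm// ler_pM2l//.
  apply: le_trans (ler_normB _ _) _.
  by have := entry Z; have := entry W; lra.
exact: entryB.
Qed.

Lemma tikhonov_cvg m p (A : 'M[R]_(m, p)) i j :
  tikhonov A a.+1%:R^-1 i j @[a --> \oo] --> mpinv A i j.
Proof.
have [K HK] := tikhonov_bound A.
apply/subr_cvg0/norm_cvg0P.
apply: (@squeeze_cvgr _ _ _ _ (cst 0) (fun a : nat => a.+1%:R^-1 * K)).
- apply: nearW => a; rewrite normr_ge0 /=.
  have := HK a.+1%:R^-1 _ i j; rewrite !mxE; apply.
  by rewrite invr_gt0 ltr0n.
- exact: cvg_cst.
- rewrite -[X in _ --> X](mul0r K); apply: cvgMr_tmp; exact: cvg_harmonic.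
Qed.

End mpinv_limit.

(** * Measurable matrix-valued functions *)

Section measurable_matrix.
Context {R : realType} d (T : measurableType d) (D : set T).

Definition mx_measurable m p (F : T -> 'M[R]_(m, p)) :=
  forall i j, measurable_fun D (fun x => F x i j).

Lemma mx_measurable_cst m p (A : 'M[R]_(m, p)) : mx_measurable (fun=> A).
Proof. by move=> i j; exact: measurable_cst. Qed.

Lemma mx_measurableD m p (F G : T -> 'M[R]_(m, p)) :
  mx_measurable F -> mx_measurable G -> mx_measurable (fun x => F x + G x).
Proof.
by move=> mF mG i j; under eq_fun do rewrite mxE; exact: measurable_funD.
Qed.

Lemma mx_measurableZ m p (F : T -> 'M[R]_(m, p)) (f : T -> R) :
  measurable_fun D f -> mx_measurable F -> mx_measurable (fun x => f x *: F x).
Proof.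
by move=> mf mF i j; under eq_fun do rewrite mxE; exact: measurable_funM.
Qed.

Lemma mx_measurableB m p (F G : T -> 'M[R]_(m, p)) :
  mx_measurable F -> mx_measurable G -> mx_measurable (fun x => F x - G x).
Proof.
by move=> mF mG i j; under eq_fun do rewrite !mxE; exact: measurable_funB.
Qed.

Lemma mx_measurable_mul m p q (F : T -> 'M[R]_(m, p)) (G : T -> 'M[R]_(p, q)) :
  mx_measurable F -> mx_measurable G -> mx_measurable (fun x => F x *m G x).
Proof.
move=> mF mG i j; under eq_fun do rewrite mxE.
by apply: measurable_sum => l; exact: measurable_funM.
Qed.

Lemma mx_measurable_tr m p (F : T -> 'M[R]_(m, p)) :
  mx_measurable F -> mx_measurable (fun x => (F x)^T).
Proof. by move=> mF i j; under eq_fun do rewrite mxE; exact: mF. Qed.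

Lemma measurable_mxdot m p (F G : T -> 'M[R]_(m, p)) :
  mx_measurable F -> mx_measurable G -> measurable_fun D (fun x => mxdot (F x) (G x)).
Proof.
move=> mF mG; under eq_fun do rewrite mxdotE.
apply: measurable_sum => i; apply: measurable_sum => j.
exact: measurable_funM.
Qed.

Lemma measurable_det n (F : T -> 'M[R]_n) :
  mx_measurable F -> measurable_fun D (fun x => \det (F x)).
Proof.
move=> mF; apply: measurable_sum => s; apply: measurable_funM => //.
by apply: measurable_prod => i _.
Qed.

Lemma measurable_inv (f : T -> R) :
  measurable_fun D f -> measurable_fun D (fun x => (f x)^-1).
Proof.
move=> mf.
(* The real power is taken at a nonnegative base; at a zero of f both sides are 0. *)
have -> : (fun x => (f x)^-1) = fun x => f x * (f x ^+ 2) `^ (- 1).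
  apply/funext => x; rewrite powR_inv1 ?sqr_ge0//.
  have [->|fx0] := eqVneq (f x) 0; first by rewrite mul0r invr0.
  by field.
apply: measurable_funM => //.
apply: (measurableT_comp (f := fun y => y `^ (-1))) => //.
exact: measurable_funX.
Qed.

Lemma mx_measurable_adj n (F : T -> 'M[R]_n) :
  mx_measurable F -> mx_measurable (fun x => \adj (F x)).
Proof.
move=> mF i j; under eq_fun do rewrite mxE.
apply: measurable_funM => //; apply: measurable_det.
by move=> a b; under eq_fun do rewrite !mxE; exact: mF.
Qed.

Lemma mx_measurable_tikhonov m p (F : T -> 'M[R]_(m, p)) e : 0 < e ->
  mx_measurable F -> mx_measurable (fun x => tikhonov (F x) e).
Proof.
move=> e0 mF.
have mS : mx_measurable (fun x => (F x)^T *m F x + e%:M).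
  apply: mx_measurableD (mx_measurable_cst _).
  by apply: mx_measurable_mul => //; exact: mx_measurable_tr.
apply: mx_measurable_mul; last exact: mx_measurable_tr.
move=> i j; under eq_fun do rewrite /invmx tikhonov_unit// mxE.
apply: measurable_funM; last exact: mx_measurable_adj.
by apply: measurable_inv; exact: measurable_det.
Qed.

Lemma mx_measurable_mpinv m p (F : T -> 'M[R]_(m, p)) :
  mx_measurable F -> mx_measurable (fun x => mpinv (F x)).
Proof.
move=> mF i j.
apply: (@measurable_fun_cvg _ _ _ _ (fun a x => tikhonov (F x) a.+1%:R^-1 i j)).
  by move=> a; apply: mx_measurable_tikhonov => //; rewrite invr_gt0 ltr0n.
by move=> x _; exact: tikhonov_cvg.
Qed.

End measurable_matrix.

(** * Densities *)

Section charge_density.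
Context d (T : measurableType d) (R : realType).
Implicit Types (nu : {charge set T -> \bar R}).
Implicit Types (la mu : {finite_measure set T -> \bar R}) (g : T -> R).

Definition has_density nu la g :=
  la.-integrable setT (EFin \o g) /\
  forall A, measurable A -> nu A = (\int[la]_(x in A) (g x)%:E)%E.

Lemma has_density_dominates nu la g : has_density nu la g -> nu `<< la.
Proof.
move=> [ig nug]; apply/null_content_dominatesP => A mA A0.
rewrite nug//; apply: null_set_integral => //.
by apply: measurable_funTS; exact: measurable_int ig.
Qed.

Lemma has_density_ae nu la g g' : has_density nu la g -> has_density nu la g' ->
  {ae la, forall x, g x = g' x}.
Proof.
move=> [ig nug] [ig' nug'].
have : ae_eq la setT (EFin \o g) (EFin \o g').
  apply: integral_ae_eq => //; first exact: measurable_int ig'.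
  by move=> A _ mA; rewrite -nug// -nug'.
by apply: filterS => x /(_ I) [].
Qed.

Lemma dominates_has_density nu la : nu `<< la ->
  has_density nu la (fun x => fine (Radon_Nikodym nu la x)).
Proof.
move=> nula.
have RNE : EFin \o (fun x => fine (Radon_Nikodym nu la x)) = Radon_Nikodym nu la.
  by apply/funext => x /=; rewrite fineK// Radon_Nikodym_fin_num.
split; first by rewrite RNE; exact: Radon_Nikodym_integrable.
move=> A mA; rewrite (Radon_Nikodym_integral nula mA).
by rewrite -[in LHS]RNE.
Qed.

Lemma charge_of_integrable la g : la.-integrable setT (EFin \o g) ->
  exists nu, has_density nu la g.
Proof. by move=> ig; exists (induced_charge ig). Qed.

Lemma integrable_mul_bounded la (D : set T) (f g : T -> R) : measurable D ->
  measurable_fun D f -> (exists M, forall x, D x -> `|f x| <= M) ->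
  la.-integrable D (EFin \o g) -> la.-integrable D (EFin \o (fun x => f x * g x)).
Proof.
move=> mD mf [M fM] ig; have /measurable_EFinP mg := measurable_int _ ig.
apply: (@le_integrable _ _ _ _ _ _ _ (EFin \o (fun x => M * g x))) => //.
- by apply/measurable_EFinP; exact: measurable_funM.
- move=> x Dx /=; rewrite lee_fin !normrM ler_wpM2r//.
  by rewrite (le_trans (fM x Dx))// ler_norm.
- have -> : EFin \o (fun x => M * g x) = fun x => (M%:E * (EFin \o g) x)%E by [].
  exact: integrableZl.
Qed.

(** The change of variables holds with the Radon-Nikodym derivative, which equals g almost
    everywhere. *)
Lemma integral_finite_density mu la (D : set T) (f g : T -> R) : measurable D ->
  la.-integrable setT (EFin \o g) ->
  (forall A, measurable A -> mu A = (\int[la]_(x in A) (g x)%:E)%E) ->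
  mu.-integrable D (EFin \o f) ->
  (\int[mu]_(x in D) (f x)%:E = \int[la]_(x in D) (f x * g x)%:E)%E.
Proof.
move=> mD ig mug intf.
have /measurable_EFinP mf := measurable_int _ intf.
have dens : has_density (charge_of_finite_measure mu) la g by [].
have muladom := has_density_dominates dens.
rewrite -(Radon_Nikodym_change_of_variables muladom mD intf).
have aeRN := has_density_ae (dominates_has_density muladom) dens.
apply: ae_eq_integral => //.
- apply: emeasurable_funM; first exact/measurable_EFinP.
  by apply: measurable_funTS; apply: measurable_int; exact: Radon_Nikodym_integrable.
- apply/measurable_EFinP/measurable_funM => //.
  by apply: measurable_funTS; apply/measurable_EFinP; exact: measurable_int ig.
- apply: filterS aeRN => x + _ => <-.
  by rewrite EFinM fineK// Radon_Nikodym_fin_num.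
Qed.

Lemma integrable_bounded mu (D : set T) (f : T -> R) : measurable D ->
  measurable_fun D f -> (exists M, forall x, D x -> `|f x| <= M) ->
  mu.-integrable D (EFin \o f).
Proof.
move=> mD mf [M fM]; apply: measurable_bounded_integrable => //.
  by rewrite -ge0_fin_numE//; exact: fin_num_measure.
exists M; split; first by rewrite num_real.
by move=> N MN x Dx /=; rewrite (le_trans (fM x Dx))// ltW.
Qed.

(** On the Hahn sets P and N the Jordan parts have densities [g * \1_P] and [- (g * \1_N)], whose
    difference is g because P and N partition the space. The pairing is thereby freed from the
    chosen Hahn decomposition. *)
Lemma cpairing_density nu la g (D : set T) (f : T -> R) : measurable D ->
  has_density nu la g ->
  measurable_fun D f -> (exists M, forall x, D x -> `|f x| <= M) ->
  cpairing D f nu = (\int[la]_(x in D) (f x * g x))%R.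
Proof.
move=> mD dg mf bf; have [ig nug] := dg.
rewrite /cpairing; have nuPN := hahnP nu.
move: (hahnP nu); set P := hahn_pos nu; set N := hahn_neg nu => {}nuPN.
have [[mP posP] [mN negN] PNT PN0] := nuPN.
have /measurable_EFinP mg := measurable_int _ ig.
have restr (B : set T) : measurable B ->
    la.-integrable setT (EFin \o (fun x => g x * \1_B x)).
  move=> mB.
  have -> : (fun x => g x * \1_B x) = (fun x => \1_B x * g x).
    by apply/funext => x; rewrite mulrC.
  apply: integrable_mul_bounded => //.
  by exists 1 => x _; rewrite indicE; case: (_ \in _); rewrite ?normr1 ?normr0.
have restrE (B A : set T) : measurable B -> measurable A ->
    nu (A `&` B) = (\int[la]_(x in A) (g x * \1_B x)%:E)%E.
  move=> mB mA; rewrite nug; last exact: measurableI.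
  rewrite integral_mkcondr; apply: eq_integral => x _.
  by rewrite /= patchE indicE; case: (_ \in _); rewrite ?mulr1 ?mulr0.
have NP x : \1_P x + \1_N x = 1 :> R.
  have : (P `|` N) x by rewrite PNT.
  have PNx : ~ (P `&` N) x by rewrite PN0.
  rewrite !indicE => -[Px|Nx].
    by rewrite mem_set// memNset ?addr0// => Nx; apply: PNx.
  by rewrite addrC mem_set// memNset ?addr0// => Px; apply: PNx.
have jpE A : measurable A ->
    jordan_pos nuPN A = (\int[la]_(x in A) (g x * \1_P x)%:E)%E.
  by move=> mA; rewrite jordan_posE cjordan_posE /crestr0 mem_set// -restrE.
have jnE A : measurable A ->
    jordan_neg nuPN A = (\int[la]_(x in A) (- (g x * \1_N x))%:E)%E.
  move=> mA; rewrite jordan_negE cjordan_negE /crestr0 mem_set// /crestr restrE//.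
  rewrite -integralN//; apply: integrable_add_def => //.
  by apply: (@integrableS _ _ _ _ setT) => //; exact: restr.
have fg : la.-integrable D (EFin \o (fun x => f x * g x)).
  apply: integrable_mul_bounded => //.
  by apply: (@integrableS _ _ _ _ setT).
have fgi (B : set T) : measurable B ->
    la.-integrable D (EFin \o (fun x => f x * (g x * \1_B x))).
  move=> mB; apply: integrable_mul_bounded => //.
  by apply: (@integrableS _ _ _ _ setT) => //; exact: restr.
rewrite /Rintegral.
rewrite (integral_finite_density mD (restr P mP) jpE); last exact: integrable_bounded.
have restrNN : la.-integrable setT (EFin \o (fun x => - (g x * \1_N x))).
  exact: integrableN (restr N mN).
rewrite (integral_finite_density mD restrNN jnE); last exact: integrable_bounded.
rewrite -!/(Rintegral _ _ _) -RintegralB//; last first.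
  under eq_fun do rewrite mulrN; exact: integrableN (fgi N mN).
- exact: fgi.
by apply: eq_Rintegral => x _; rewrite mulrN opprK -mulrDr -mulrDr NP mulr1.
Qed.

End charge_density.

(** * Change of reference measure *)

Section change_of_measure.
Context d (T : measurableType d) (R : realType).
Context (mu la : {finite_measure set T -> \bar R}).

(** In the last clause f is any measurable function and the integrals are extended-real: it applies
    to squared norms that may be infinite, and integrability can be read off from it. *)
Definition change_density (h : T -> R) :=
  [/\ forall x, 0 <= h x, la.-integrable setT (EFin \o h),
      forall A, measurable A -> mu A = (\int[la]_(x in A) (h x)%:E)%E &
      forall (D : set T) (f : T -> R), measurable D -> measurable_fun D f ->
        (\int[mu]_(x in D) (f x)%:E = \int[la]_(x in D) (f x * h x)%:E)%E].

Lemma change_density_exists : mu `<< la -> exists h, change_density h.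
Proof.
move=> mula; pose H := Radon_Nikodym_SigmaFinite.f mu la.
have H0 := Radon_Nikodym_SigmaFinite.f_ge0 mula.
have HE x : (fine (H x))%:E = H x.
  by rewrite fineK//; exact: Radon_Nikodym_SigmaFinite.f_fin_num.
exists (fun x => fine (H x)); split.
- by move=> x; rewrite fine_ge0// H0.
- rewrite (_ : _ \o _ = H); first exact: Radon_Nikodym_SigmaFinite.f_integrable.
  by apply/funext => x /=; rewrite HE.
- move=> A mA; rewrite (Radon_Nikodym_SigmaFinite.f_integral mula mA).
  by apply: eq_integral => x _; rewrite HE.
- move=> D f mD mf; pose F := EFin \o f.
  have mF : measurable_fun D F by exact/measurable_EFinP.
  have cov := Radon_Nikodym_SigmaFinite.change_of_variables mula.
  (* As h >= 0, the change of variables for nonnegative functions applies to the positive and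
     negative parts separately. *)
  rewrite integralE [RHS]integralE; congr (_ - _)%E.
    rewrite -cov//; last exact: measurable_funepos.
    apply: eq_integral => x _; rewrite !funeposE EFinM HE.
    by rewrite -/H maxe_pMl// ?mul0e// -HE.
  rewrite -cov//; last exact: measurable_funeneg.
  apply: eq_integral => x _; rewrite !funenegE EFinM HE.
  by rewrite -/H maxe_pMl// ?mul0e ?mulNe// -HE.
Qed.

Variable h : T -> R.
Hypothesis hP : change_density h.

Let h0 x : 0 <= h x. Proof. by case: hP. Qed.

Lemma change_density_measurable : measurable_fun setT h.
Proof. by case: hP => _ ih _ _; apply/measurable_EFinP; exact: measurable_int ih. Qed.

Lemma change_density_integrable (D : set T) (f : T -> R) : measurable D ->
  measurable_fun D f ->
  mu.-integrable D (EFin \o f) <-> la.-integrable D (EFin \o (fun x => f x * h x)).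
Proof.
move=> mD mf; case: hP => _ ih _ cov.
have mh : measurable_fun D h.
  by apply: measurable_funTS; exact: change_density_measurable.
have normE : (\int[mu]_(x in D) `|(f x)%:E| = \int[la]_(x in D) `|(f x * h x)%:E|)%E.
  rewrite (cov _ (fun x => `|f x|))//; last exact: measurableT_comp.
  by apply: eq_integral => x _ /=; rewrite normrM (ger0_norm (h0 x)).
split=> /integrableP[_ fin]; apply/integrableP; split.
- by apply/measurable_EFinP/measurable_funM.
- by rewrite -normE.
- exact/measurable_EFinP.
- by rewrite normE.
Qed.

Lemma change_density_has_density (nu : {charge set T -> \bar R}) g :
  has_density nu mu g -> has_density nu la (fun x => g x * h x).
Proof.
case: hP => _ ih _ cov [ig nug].
have /measurable_EFinP mg := measurable_int _ ig.
split; first exact/change_density_integrable.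
by move=> A mA; rewrite nug// cov//; exact: measurable_funTS.
Qed.

Lemma change_density_null A : measurable A -> mu A = 0%E ->
  {ae la, forall x, A x -> h x = 0}.
Proof.
move=> mA muA0; case: hP => _ ih muE _.
have : (\int[la]_(x in A) `|(h x)%:E| = 0)%E.
  rewrite -muA0 muE//; apply: eq_integral => x _ /=.
  by rewrite ger0_norm.
move/ae_eq_integral_abs => /(_ mA).
have mh : measurable_fun A (EFin \o h) by apply: measurable_funTS; exact: measurable_int ih.
by move=> /(_ mh); apply: filterS => x H /H [].
Qed.

(** [mu] ignores the zeros of h, so what holds almost everywhere for [mu] passes to [la] only off
    them; at those zeros the factor h makes the identities to be transferred trivial. *)
Lemma change_density_ae (P : T -> Prop) :
  {ae mu, forall x, P x} -> {ae la, forall x, h x = 0 \/ P x}.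
Proof.
move=> [N [mN N0 PN]].
apply: filterS (change_density_null mN N0) => x Nh0.
by have [Px|nPx] := pselect (P x); [right|left; apply: Nh0; exact: PN].
Qed.

Lemma change_density_neq0 : {ae mu, forall x, h x != 0}.
Proof.
case: hP => _ ih muE _.
exists (h @^-1` [set 0]); split.
- by rewrite -[X in measurable X]setTI; exact: change_density_measurable.
- rewrite muE; last by rewrite -[X in measurable X]setTI; exact: change_density_measurable.
  by apply: integral0_eq => x /= ->.
- by move=> x /= /negP; rewrite negbK => /eqP.
Qed.

Lemma dominates_ae (P : T -> Prop) : mu `<< la ->
  {ae la, forall x, P x} -> {ae mu, forall x, P x}.
Proof.
move=> /null_content_dominatesP mula [N [mN N0 PN]]; exists N; split => //.
exact: mula.
Qed.

End change_of_measure.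

Section sum_variation_dominates.
Context d (T : measurableType d) (R : realType).
Implicit Types (s : seq ({charge set T -> \bar R})).

Lemma sum_variation_dominates s (i : nat) : (i < size s)%N ->
  nth (czero : {charge set T -> \bar R}) s i `<< sum_variation s.
Proof.
move=> si; apply/null_content_dominatesP => A mA.
rewrite /sum_variation /msum => /eqP; rewrite seq_psume_eq0// => /allP/(_ (Ordinal si)).
rewrite mem_index_enum => /(_ isT) /= /eqP var0.
apply/eqP; rewrite -abse_eq0 eq_le abse_ge0 andbT -var0.
exact: abse_charge_variation.
Qed.

Lemma dominates_sum_variation s (la : {measure set T -> \bar R}) :
  (forall i, (i < size s)%N -> nth (czero : {charge set T -> \bar R}) s i `<< la) ->
  sum_variation s `<< la.
Proof.
move=> sla; apply/null_content_dominatesP => A mA A0.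
rewrite /sum_variation /msum big1// => i _.
by have /null_charge_dominatesP := sla i (ltn_ord i); apply.
Qed.

End sum_variation_dominates.

(** * Projection in a semi-definite inner product space *)

Section pre_hilbert.
Context (R : realType) (V : lmodType R) (L : V -> Prop) (b : V -> V -> R).
Hypothesis L_lin : forall c u v, L u -> L v -> L (u + c *: v).
Hypothesis b_sym : forall u v, L u -> L v -> b u v = b v u.
Hypothesis b_lin : forall c u v w, L u -> L v -> L w ->
  b (u + c *: v) w = b u w + c * b v w.
Hypothesis b_ge0 : forall u, L u -> 0 <= b u u.

Definition form_closure (S : V -> Prop) (v : V) :=
  L v /\ forall e, 0 < e -> exists2 s, S s & b (v - s) (v - s) < e.

Lemma form_memB u v : L u -> L v -> L (u - v).
Proof. by move=> Lu Lv; rewrite -scaleN1r; exact: L_lin. Qed.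

Lemma formBl u v w : L u -> L v -> L w -> b (u - v) w = b u w - b v w.
Proof. by move=> *; rewrite -scaleN1r b_lin// mulN1r. Qed.

Lemma formBr u v w : L u -> L v -> L w -> b w (u - v) = b w u - b w v.
Proof.
by move=> Lu Lv Lw; rewrite b_sym ?formBl//; [rewrite !(b_sym Lw)|exact: form_memB].
Qed.

Lemma form_expand t u v : L u -> L v ->
  b (u + t *: v) (u + t *: v) = b u u + 2 * t * b u v + t ^+ 2 * b v v.
Proof.
move=> Lu Lv; have Lw := L_lin t Lu Lv.
rewrite b_lin// (b_sym Lu)// (b_sym Lv)// !b_lin// (b_sym Lv Lu); ring.
Qed.

Lemma form_sqrB u v : L u -> L v ->
  b (u - v) (u - v) = b u u - 2 * b u v + b v v.
Proof. by move=> Lu Lv; rewrite -scaleN1r form_expand//; ring. Qed.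

Lemma form_cauchy_schwarz u v : L u -> L v -> b u v ^+ 2 <= b u u * b v v.
Proof.
move=> Lu Lv; apply: sqr_le_of_quadratic => [|t]; first exact: b_ge0.
by rewrite -form_expand//; apply: b_ge0; exact: L_lin.
Qed.

(** Since s is orthogonal to x, [b w x] equals [b (w - s) x], which Cauchy-Schwarz makes small for s
    near w. *)
Lemma form_closure_ortho (S : V -> Prop) w x : (forall s, S s -> L s) ->
  form_closure S w -> L x -> (forall s, S s -> b s x = 0) -> b w x = 0.
Proof.
move=> SL [Lw clw] Lx Sx; apply/eqP; rewrite -sqrf_eq0; apply/eqP/le_anti.
rewrite sqr_ge0 andbT; apply/ler_addgt0Pr => e e0; rewrite add0r.
(* The added 1 keeps the tolerance meaningful when x has norm zero. *)
have x1 : 0 < b x x + 1 by have := b_ge0 Lx; lra.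
have [s Ss ws] := clw (e / (b x x + 1)) (divr_gt0 e0 x1).
have Ls := SL _ Ss; have Lws := form_memB Lw Ls.
have -> : b w x = b (w - s) x by rewrite formBl// (Sx _ Ss) subr0.
apply: le_trans (form_cauchy_schwarz Lws Lx) _.
have := b_ge0 Lws; have := b_ge0 Lx.
move: ws; rewrite ltr_pdivlMr//; set p := b _ _; set q := b x x; nra.
Qed.

(* Fast Cauchy sequences suffice, as a minimizing sequence can be chosen with
   any prescribed rate. *)
Hypothesis complete : forall u : nat -> V, (forall m, L (u m)) ->
  (forall m j, (m <= j)%N -> b (u m - u j) (u m - u j) <= 16%:R^-1 ^+ m) ->
  exists2 v, L v & forall m, b (v - u m) (v - u m) <= 16%:R^-1 ^+ m.

Variable S : V -> Prop.
Hypothesis SL : forall s, S s -> L s.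
Hypothesis S0 : exists s, S s.
Hypothesis S_lin : forall c s t, S s -> S t -> S (s + c *: t).

(** A minimizing sequence for the distance from v0 to S. The limit is a projection only modulo
    vectors of norm zero, so it is described by its inner products with S. *)
Lemma projection v0 : L v0 ->
  exists2 v, form_closure S v & forall s, S s -> b s v = b s v0.
Proof.
move=> Lv0; pose q s := b (v0 - s) (v0 - s).
have q0 s : S s -> 0 <= q s by move=> Ss; apply: b_ge0; apply: form_memB => //; exact: SL.
pose I := [set q s | s in S]; pose dl := inf I.
have hI : has_inf I.
  split; first by have [s Ss] := S0; exists (q s), s.
  by exists 0 => _ [s Ss <-]; exact: q0.
have dl_le s : S s -> dl <= q s.
  by move=> Ss; apply: ge_inf; [exact: hI.2|exists s].
(* The midpoint of u m and u j lies in S, so the parallelogram law gives |u m - u j|^2 <= 2 (eps m +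
   eps j) <= 4 eps m, the rate that [complete] expects. *)
pose eps m : R := 16%:R^-1 ^+ m / 4.
have pow0 m : 0 < (16%:R^-1 : R) ^+ m by rewrite exprn_gt0// invr_gt0.
have eps0 m : 0 < eps m by rewrite divr_gt0.
have /choice[u uP] : forall m, exists s, S s /\ q s < dl + eps m.
  by move=> m; have [_ [s Ss <-] ?] := inf_adherent (eps0 m) hI; exists s.
have Lu m : L (u m) by apply: SL; exact: (uP m).1.
have Lr m : L (v0 - u m) by exact: form_memB.
have cauchy m j : (m <= j)%N -> b (u m - u j) (u m - u j) <= 16%:R^-1 ^+ m.
  move=> mj; pose mid := u m + 2^-1 *: (u j - u m).
  have Smid : S mid.
    by rewrite /mid -scaleN1r; apply: S_lin (uP m).1 _; apply: S_lin; exact: (uP _).1.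
  have -> : u m - u j = (v0 - u j) - (v0 - u m) by rewrite opprB [RHS]addrC addrA subrK.
  have midE : v0 - mid = (v0 - u m) + 2^-1 *: ((v0 - u j) - (v0 - u m)).
    rewrite /mid opprD addrA -scalerN opprB; congr (_ + _ *: _).
    by rewrite opprB [RHS]addrC addrA subrK.
  have := dl_le _ Smid; rewrite /q midE (form_expand _ (Lr m) (form_memB (Lr j) (Lr m))).
  rewrite (form_sqrB (Lr j) (Lr m)) (formBr (Lr j) (Lr m) (Lr m)).
  have := (uP m).2; have := (uP j).2; rewrite /q (b_sym (Lr j) (Lr m)).
  have : eps j <= eps m.
    by rewrite /eps ler_pM2r ?invr_gt0// ler_wiXn2l// ?invr_ge0 ?invf_le1 ?ler1n.
  rewrite /eps; have := pow0 m; lra.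
have [v Lv vu] := complete Lu cauchy.
exists v.
  split=> // e e0.
  have [m] : exists m, 16%:R^-1 ^+ m < e.
    have : (16%:R^-1 : R) ^+ m @[m --> \oo] --> 0.
      by apply: cvg_expr; rewrite ger0_norm ?invr_ge0// invf_lt1 ?ltr1n.
    move=> /cvgrPdist_lt/(_ _ e0)[N _ NP]; exists N; have := NP N (leqnn N).
    by rewrite /= sub0r normrN gtr0_norm.
  by move=> me; exists (u m); [exact: (uP m).1|exact: le_lt_trans (vu m) me].
move=> s Ss; have Ls := SL Ss.
(* Moving u m by a multiple of s cannot bring q below dl, while q (u m) exceeds dl by less than eps
   m; the discriminant then bounds the inner product. *)
have near_ortho m : b (v0 - u m) s ^+ 2 <= eps m * b s s.
  apply: sqr_le_of_quadratic => [|t]; first exact: b_ge0.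
  have St : S (u m + (- t) *: s) by apply: S_lin => //; exact: (uP m).1.
  have := dl_le _ St; rewrite /q opprD addrA scaleNr opprK form_expand//.
  by have := (uP m).2; rewrite /q; lra.
have close m : b (v - u m) s ^+ 2 <= 16%:R^-1 ^+ m * b s s.
  have Lvu : L (v - u m) by exact: form_memB.
  apply: le_trans (form_cauchy_schwarz Lvu Ls) _.
  by rewrite ler_wpM2r ?b_ge0.
have bound m : (b s v - b s v0) ^+ 2 <= 16%:R^-1 ^+ m * (4 * b s s).
  have -> : b s v - b s v0 = b (v - u m) s - b (v0 - u m) s.
    by rewrite !formBl// (b_sym Ls Lv) (b_sym Ls Lv0); ring.
  have := near_ortho m; have := close m; have := b_ge0 Ls.
  rewrite /eps; move: (pow0 m) (b (v - u m) s) (b (v0 - u m) s) (b s s).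
  move: (_ ^+ m) => p p0 x y z z0 xz yz.
  have : 0 <= (x + y) ^+ 2 by exact: sqr_ge0.
  by have := mulr_ge0 (ltW p0) z0; nra.
apply/eqP; rewrite -subr_eq0 -sqrf_eq0; apply/eqP/le_anti.
rewrite sqr_ge0 andbT.
have : (16%:R^-1 : R) ^+ m * (4 * b s s) @[m --> \oo] --> 0 * (4 * b s s).
  apply: cvgMr_tmp; apply: cvg_expr.
  by rewrite ger0_norm ?invr_ge0// invf_lt1 ?ltr1n.
rewrite mul0r => cv; rewrite -(cvg_lim _ cv)//.
by apply: limr_ge; [apply/cvg_ex; exists 0|exact: nearW].
Qed.

End pre_hilbert.

(** * Minimum norm problems for a semi-definite form *)

Section minimum_norm_problem.
Context (R : realType) (V : lmodType R) (L : V -> Prop) (b : V -> V -> R).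
Hypothesis L_lin : forall c u v, L u -> L v -> L (u + c *: v).
Hypothesis b_sym : forall u v, L u -> L v -> b u v = b v u.
Hypothesis b_lin : forall c u v w, L u -> L v -> L w ->
  b (u + c *: v) w = b u w + c * b v w.
Hypothesis b_ge0 : forall u, L u -> 0 <= b u u.
Hypothesis complete : forall u : nat -> V, (forall m, L (u m)) ->
  (forall m j, (m <= j)%N -> b (u m - u j) (u m - u j) <= 16%:R^-1 ^+ m) ->
  exists2 v, L v & forall m, b (v - u m) (v - u m) <= 16%:R^-1 ^+ m.
Context (I : Type) (P : I -> V) (i0 : I).
Hypothesis LP : forall i, L (P i).
Hypothesis P_lin : forall c i j, exists m, P m = P i + c *: P j.
Context (ell : I -> R).

Definition form_dist u v := Num.sqrt (b (u - v) (u - v)).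

Definition span_closure v :=
  L v /\ forall e, 0 < e -> exists i, form_dist v (P i) < e.

Definition extends l := (forall i, l (P i) = ell i) /\
  forall v, span_closure v -> forall e : R, 0 < e -> exists2 dl : R, 0 < dl &
    forall w, span_closure w -> form_dist w v < dl -> `|l w - l v| < e.

Definition represents (l : V -> R) v := span_closure v /\
  forall w, span_closure w -> l w = b w v.

Definition solves v := L v /\ forall i, b (P i) v = ell i.

Let S s := exists i, s = P i.

Let LB u v : L u -> L v -> L (u - v).
Proof. exact: form_memB. Qed.

Let SL s : S s -> L s.
Proof. by move=> [i ->]. Qed.

Lemma form_dist_lt u v e : 0 < e -> (form_dist u v < e) = (b (u - v) (u - v) < e ^+ 2).
Proof.
move=> e0; rewrite /form_dist -[X in _ < X](ger0_norm (ltW e0)) -sqrtr_sqr ltr_sqrt//.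
by rewrite exprn_gt0.
Qed.

Lemma form_dist_sym u v : L u -> L v -> form_dist u v = form_dist v u.
Proof.
move=> Lu Lv; rewrite /form_dist (form_sqrB L_lin b_sym b_lin Lu Lv).
by rewrite (form_sqrB L_lin b_sym b_lin Lv Lu) (b_sym Lu Lv); congr Num.sqrt; ring.
Qed.

Lemma span_closureP v : span_closure v <-> form_closure L b S v.
Proof.
split=> -[Lv clv]; split=> // e e0.
  have se : 0 < Num.sqrt e by rewrite sqrtr_gt0.
  have [i] := clv _ se; rewrite form_dist_lt// sqr_sqrtr ?ltW// => vi.
  by exists (P i); [exists i|].
have [_ [i ->] vi] := clv _ (exprn_gt0 2 e0).
by exists i; rewrite form_dist_lt.
Qed.

Lemma span_closure_generator i : span_closure (P i).
Proof.
split=> // e e0; exists i; rewrite /form_dist (form_sqrB L_lin b_sym b_lin)//.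
by rewrite (_ : _ + _ = 0) ?sqrtr0//; ring.
Qed.

Context (v0 : V).
Hypothesis v0_solves : solves v0.

Let Lv0 : L v0. Proof. by case: v0_solves. Qed.
Let v0E i : b (P i) v0 = ell i. Proof. by case: v0_solves. Qed.
Let HL v : span_closure v -> L v. Proof. by case. Qed.

Lemma extends_dot : extends (b ^~ v0).
Proof.
split=> // v Hv e e0; have Lv := HL Hv; have c0 := b_ge0 Lv0.
have c1 : 0 < b v0 v0 + 1 by rewrite ltr_wpDl.
(* With c = b v0 v0, Cauchy-Schwarz needs dl^2 c <= e^2; c <= (c + 1)^2 makes this radius work
   without a root, including when c = 0. *)
exists (e / (b v0 v0 + 1)) => [|w Hw]; first by rewrite divr_gt0.
have Lw := HL Hw; have Lwv := LB Lw Lv.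
rewrite form_dist_lt ?divr_gt0// -(formBl b_lin Lw Lv Lv0) => wv.
rewrite ltNge; apply/negP => le_e.
have := form_cauchy_schwarz L_lin b_sym b_lin b_ge0 Lwv Lv0.
have e2 : e ^+ 2 <= b (w - v) v0 ^+ 2.
  by rewrite -[leRHS]real_normK ?num_real// ler_sqr ?nnegrE// ltW.
move: wv; rewrite expr_div_n ltr_pdivlMr ?exprn_gt0//.
have := b_ge0 Lwv; move: (b (w - v) (w - v)) (b v0 v0) (b (w - v) v0) c0 c1 e2.
move=> p c x c0 c1 e2 p0 pc xpc.
by have := mulr_ge0 p0 c0; have := mulr_ge0 p0 (sqr_ge0 c); nra.
Qed.

(** Density: a generator close to v for both moduli of continuity has the same value [ell i] under l
    and under [b ^~ v0], and each differs from it by less than e / 2 at v. *)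
Lemma extends_unique l : extends l -> forall v, span_closure v -> l v = b v v0.
Proof.
move=> [lE lc] v Hv; have [_ bc] := extends_dot.
apply/eqP; rewrite -subr_eq0 -normr_le0; apply/ler_addgt0Pr => e e0.
have e20 : 0 < e / 2 by rewrite divr_gt0.
have [d1 d10 d1P] := lc _ Hv _ e20; have [d2 d20 d2P] := bc _ Hv _ e20.
have [Lv clv] := Hv; have d0 : 0 < Num.min d1 d2 by rewrite lt_min d10.
have [i] := clv _ d0; rewrite form_dist_sym// lt_min => /andP[i1 i2].
have := d1P _ (span_closure_generator i) i1.
have := d2P _ (span_closure_generator i) i2.
rewrite lE v0E => A1 A2; rewrite add0r.
have -> : l v - b v v0 = (ell i - b v v0) - (ell i - l v) by ring.
by rewrite (le_trans (ler_normB _ _))//; lra.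
Qed.

(** Projecting the solution v0 onto the closure keeps its inner products with the generators and, by
    density, with the whole closure. *)
Lemma represents_exists : exists v, represents (b ^~ v0) v.
Proof.
have S_lin c s t : S s -> S t -> S (s + c *: t).
  by move=> [i ->] [j ->]; have [m mE] := P_lin c i j; exists m.
have S0 : exists s, S s by exists (P i0), i0.
have [v clv vE] := projection L_lin b_sym b_lin b_ge0 complete SL S0 S_lin Lv0.
have Hv : span_closure v by exact/span_closureP.
exists v; split=> // w Hw; have Lv := HL Hv; have Lw := HL Hw.
have /span_closureP clw := Hw.
have : b w (v0 - v) = 0.
  apply: (form_closure_ortho L_lin b_sym b_lin b_ge0 SL clw); first exact: LB.
  move=> s Ss; have Ls := SL Ss.
  by rewrite (formBr L_lin b_sym b_lin Lv0 Lv Ls) (vE _ Ss) subrr.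
by rewrite (formBr L_lin b_sym b_lin Lv0 Lv Lw) => /eqP; rewrite subr_eq0 => /eqP.
Qed.

Context (l : V -> R) (v : V).
Hypothesis lE : forall i, l (P i) = ell i.
Hypothesis v_repr : represents l v.

Lemma represents_solves : solves v.
Proof.
have [Hv vE] := v_repr; split; first exact: HL.
by move=> i; rewrite -vE//; exact: span_closure_generator.
Qed.

(** The difference w - v is orthogonal to every generator, hence to the closure, which contains v.
    Minimality of v and uniqueness up to norm zero both come from here. *)
Lemma solves_pythagoras w : solves w -> b w w = b v v + b (w - v) (w - v).
Proof.
move=> [Lw wE]; have [Lv vE] := represents_solves.
have ortho : b v (w - v) = 0.
  have [/span_closureP clv _] := v_repr.
  apply: (form_closure_ortho L_lin b_sym b_lin b_ge0 SL clv); first exact: LB.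
  by move=> _ [i ->]; rewrite (formBr L_lin b_sym b_lin Lw Lv (LP i)) vE wE subrr.
move: ortho; rewrite (formBr L_lin b_sym b_lin Lw Lv Lv) => /eqP.
rewrite subr_eq0 => /eqP vw.
by rewrite (form_sqrB L_lin b_sym b_lin Lw Lv) (b_sym Lw Lv) vw; ring.
Qed.

(** Completing the square: the dual objective misses half the squared norm of v by half the squared
    distance from v to a generator, which density makes arbitrarily small. *)
Lemma dual_gap i : ell i - 2^-1 * b (P i) (P i) =
  2^-1 * b v v - 2^-1 * form_dist v (P i) ^+ 2.
Proof.
have [Lv vE] := represents_solves.
rewrite sqr_sqrtr; last by apply: b_ge0; exact: LB.
by rewrite (form_sqrB L_lin b_sym b_lin Lv (LP i)) (b_sym Lv (LP i)) vE; field.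
Qed.

End minimum_norm_problem.

(** * Completeness of the weighted L2 spaces *)

Section scalar_limits.
Context {R : realType}.

Lemma normr_le_of_sqr (x y : R) : 0 <= y -> x ^+ 2 <= y ^+ 2 -> `|x| <= y.
Proof. by move=> y0 xy; rewrite ler_norml; apply/andP; split; nra. Qed.

Lemma cvg_of_summable_squares (z p : nat -> R) (a K : R) : 0 <= a ->
  (forall i, (z i.+1 - z i) ^+ 2 <= a * p i) ->
  (forall i, 4%:R ^+ i * p i <= K) ->
  cvg (z @ \oo).
Proof.
(* From p i <= K / 4^i the increments of z are at most sqrt (a |K|) / 2^i, and w <= (1 + w)^2 shows
   that C bounds that root. *)
move=> a0 zp pK; pose C := 1 + a * `|K|.
have C0 : 1 <= C by rewrite lerDl mulr_ge0.
have step i : `|z i.+1 - z i| <= C * 2^-1 ^+ i.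
  have t0 : 0 < (2^-1 : R) ^+ i by rewrite exprn_gt0.
  have t4 : (2^-1 : R) ^+ i ^+ 2 * 4%:R ^+ i = 1.
    rewrite -exprM mulnC exprM -exprMn -[RHS](expr1n _ i); congr (_ ^+ _); by field.
  apply: normr_le_of_sqr; first by rewrite mulr_ge0 ?ltW// (lt_le_trans _ C0).
  rewrite (le_trans (zp i))// exprMn.
  move: t0 t4 (pK i) (ler_norm K); move: (2^-1 ^+ i) (4%:R ^+ i) => t f t0 tf fp K1.
  have t2 : 0 < t ^+ 2 by rewrite exprn_gt0.
  have pE : p i = t ^+ 2 * (f * p i) by rewrite mulrA tf mul1r.
  have yK : f * p i <= `|K| by exact: le_trans fp K1.
  rewrite pE; move: (f * p i) yK => y yK.
  have : t ^+ 2 * (a * y) <= t ^+ 2 * (a * `|K|).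
    rewrite ler_pM2l//; exact: ler_wpM2l.
  have : t ^+ 2 * (a * `|K|) <= t ^+ 2 * C ^+ 2.
    rewrite ler_pM2l//; rewrite /C; have := mulr_ge0 a0 (normr_ge0 K).
    move: (a * `|K|) => w w0; nra.
  lra.
have cvS : cvg (series (telescope z) @ \oo).
  apply: normed_cvg; apply: (@series_le_cvg _ _ (geometric C 2^-1)).
  - by move=> i /=; exact: normr_ge0.
  - by move=> i /=; rewrite mulr_ge0 ?exprn_ge0 ?(le_trans _ C0).
  - exact: step.
  - by apply: is_cvg_geometric_series; rewrite ger0_norm ?invr_ge0// invf_lt1 ?ltr1n.
have -> : z = (fun i => z 0%N + series (telescope z) i).
  by apply/funext => i; exact: eq_sum_telescope.
by apply: is_cvgD => //; exact: is_cvg_cst.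
Qed.

Lemma limn_einf_le_bound (u : (\bar R)^nat) M :
  (forall i, u i <= M)%E -> (limn_einf u <= M)%E.
Proof.
move=> uM; rewrite limn_einf_lim; apply: lime_le; first exact: is_cvg_einfs.
apply: nearW => i; apply: le_trans (uM i).
by apply: ereal_inf_lbound; exists i => /=.
Qed.

Lemma cvg_sumr (I : Type) (r : seq I) (f : I -> nat -> R) (l : I -> R) :
  (forall i, f i a @[a --> \oo] --> l i) ->
  \sum_(i <- r) f i a @[a --> \oo] --> \sum_(i <- r) l i.
Proof.
move=> fl; elim: r => [|i r IH].
  by rewrite big_nil; under eq_fun do rewrite big_nil; exact: cvg_cst.
by rewrite big_cons; under eq_fun do rewrite big_cons; exact: cvgD.
Qed.

Lemma cvg_EFin_seq (u : nat -> R) l :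
  u a @[a --> \oo] --> l -> (u a)%:E @[a --> \oo] --> l%:E.
Proof. by move=> ul; apply: cvg_EFin => //; exact: nearW. Qed.

Definition mx_cvg m p (Z : nat -> 'M[R]_(m, p)) (Y : 'M[R]_(m, p)) :=
  forall i j, Z a i j @[a --> \oo] --> Y i j.

Lemma mx_cvg_unique m p (Z : nat -> 'M[R]_(m, p)) Y Y' :
  mx_cvg Z Y -> mx_cvg Z Y' -> Y = Y'.
Proof.
by move=> ZY ZY'; apply/matrixP => i j; apply: (cvg_unique _ (ZY i j) (ZY' i j)).
Qed.

Lemma mx_cvg_mull m p q (B : 'M[R]_(q, m)) (Z : nat -> 'M[R]_(m, p)) Y :
  mx_cvg Z Y -> mx_cvg (fun a => B *m Z a) (B *m Y).
Proof.
move=> ZY i j; rewrite mxE; under eq_fun do rewrite mxE.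
apply: cvg_sumr => l; apply: cvgMl_tmp; exact: ZY.
Qed.

Lemma mx_cvgBr m p (B : 'M[R]_(m, p)) (Z : nat -> 'M[R]_(m, p)) Y :
  mx_cvg Z Y -> mx_cvg (fun a => Z a - B) (Y - B).
Proof.
move=> ZY i j; rewrite !mxE; under eq_fun do rewrite !mxE.
by apply: cvgB; [exact: ZY|exact: cvg_cst].
Qed.

Lemma cvg_mxdot m p (Z U : nat -> 'M[R]_(m, p)) Y X :
  mx_cvg Z Y -> mx_cvg U X -> mxdot (Z a) (U a) @[a --> \oo] --> mxdot Y X.
Proof.
move=> ZY UX; rewrite mxdotE; under eq_fun do rewrite mxdotE.
by apply: cvg_sumr => i; apply: cvg_sumr => j; apply: cvgM.
Qed.

End scalar_limits.

(** * Square integrable fields for one matrix weight *)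

Section weighted_fields.
Context d (T : measurableType d) (R : realType).
Context (mu : {finite_measure set T -> \bar R}) (D : set T) (mD : measurable D).
Context n (A : T -> 'M[R]_n).
Hypothesis Apsd : forall x, psdmx (A x).
Hypothesis mA : mx_measurable D A.

Section fixed_width.
Context {m : nat}.
Implicit Types V W : T -> 'M[R]_(n, m).

Definition wdot V W : T -> R := fun x => mxdot (V x) (A x *m W x).

Definition sq_integrable V :=
  mx_measurable D V /\ mu.-integrable D (EFin \o wdot V V).

Lemma wdot_ge0 V x : 0 <= wdot V V x.
Proof. exact: psdmx_mxdot_ge0. Qed.

Lemma measurable_wdot V W : mx_measurable D V -> mx_measurable D W ->
  measurable_fun D (wdot V W).
Proof.
by move=> mV mW; apply: measurable_mxdot => //; exact: mx_measurable_mul.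
Qed.

Lemma wdot_integrable V W : sq_integrable V -> sq_integrable W ->
  mu.-integrable D (EFin \o wdot V W).
Proof.
move=> [mV iV] [mW iW].
(* Cauchy-Schwarz at each point, with x y <= (x + y)^2 for x, y >= 0, gives the dominating
   function. *)
apply: (@le_integrable _ _ _ _ _ mD _ (EFin \o (fun x => wdot V V x + wdot W W x))).
- by apply/measurable_EFinP; exact: measurable_wdot.
- move=> x Dx /=; rewrite lee_fin.
  have := psdmx_cauchy_schwarz (Apsd x) (V x) (W x); rewrite -/(wdot V W x).
  have := wdot_ge0 V x; have := wdot_ge0 W x.
  rewrite -/(wdot V V x) -/(wdot W W x) => a0 b0 ab.
  rewrite (ger0_norm (addr_ge0 _ _))//.
  by apply: normr_le_of_sqr; [exact: addr_ge0|nra].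
- have -> : EFin \o (fun x => wdot V V x + wdot W W x) =
    ((EFin \o wdot V V) \+ (EFin \o wdot W W))%E by [].
  exact: integrableD.
Qed.

Lemma sq_integrableD c V W : sq_integrable V -> sq_integrable W ->
  sq_integrable (fun x => V x + c *: W x).
Proof.
move=> sV sW; have [mV iV] := sV; have [mW iW] := sW.
have iVW := wdot_integrable sV sW.
split.
  by apply: mx_measurableD => //; apply: (mx_measurableZ (f := fun=> c)).
have -> : EFin \o wdot (fun x => V x + c *: W x) (fun x => V x + c *: W x) =
    ((EFin \o wdot V V) \+ ((fun x => (2 * c)%:E * (EFin \o wdot V W) x) \+
      (fun x => (c ^+ 2)%:E * (EFin \o wdot W W) x)))%E.
  by apply/funext => x /=; rewrite /wdot (psdmx_mxdot_expand (Apsd x)) -!EFinM -!EFinD addrA.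
by apply: integrableD => //; apply: integrableD => //; exact: integrableZl.
Qed.

(** The seminorm of V depends on A V alone, through a quadratic form whose matrix is fixed at each
    x; in this form it passes to the limit. *)
Lemma wdot_rangeE (x : T) (V : 'M[R]_(n, m)) :
  mxdot V (A x *m V) = mxdot (A x *m V) (mpinv (A x) *m (A x *m V)).
Proof.
have [symA _] := Apsd x; have [AAA _ _ _] := mpinvP (A x).
have {1}-> : A x *m V = A x *m (mpinv (A x) *m (A x *m V)) by rewrite !mulmxA AAA.
by rewrite mxdot_mull symA.
Qed.

(* The fields V a are controlled only modulo the kernel of A, so it is A V a
   that converges almost everywhere, to some Y; the limit field is the
   Moore-Penrose solution W of A W = Y, and Fatou's lemma gives the rate. *)
Lemma sq_integrable_complete (V : nat -> T -> 'M[R]_(n, m)) :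
  (forall a, sq_integrable (V a)) ->
  (forall a b, (a <= b)%N ->
    (\int[mu]_(x in D) (wdot (V a \- V b) (V a \- V b) x)%:E
      <= (16%:R^-1 ^+ a)%:E)%E) ->
  exists2 W, mx_measurable D W & forall a,
    (\int[mu]_(x in D) (wdot (W \- V a) (W \- V a) x)%:E
      <= (16%:R^-1 ^+ a)%:E)%E.
Proof.
move=> sV cauchy.
have mV a : mx_measurable D (V a) by have [] := sV a.
have mVB a b : mx_measurable D (V a \- V b) by exact: mx_measurableB.
pose p a x := wdot (V a \- V a.+1) (V a \- V a.+1) x.
have mp a : measurable_fun D (p a) by exact: measurable_wdot.
(* The rate 16^-a is spent twice. Weighted by 4^a the squared increments still have integral at most
   4^-a, so their sum is finite almost everywhere; there p a x <= K / 4^a, and the entries of A V_a,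
   whose increments are of the order of the square root, converge. *)
pose f a x : \bar R := (4%:R ^+ a * p a x)%:E.
have f0 a x : D x -> (0 <= f a x)%E.
  by move=> _; rewrite lee_fin mulr_ge0 ?exprn_ge0// wdot_ge0.
have mf a : measurable_fun D (f a) by apply/measurable_EFinP/measurable_funM.
(* The bound is 2^-a, written as a term of a geometric series of sum 2; the integral is even at most
   4^-a. *)
have intf a : (\int[mu]_(x in D) f a x <= (2 / (2 ^ (a + 0.+1))%:R)%:E)%E.
  rewrite /f; under eq_integral do rewrite EFinM.
  rewrite ge0_integralZl_EFin ?exprn_ge0//; last 2 first.
  - by move=> x _; rewrite lee_fin wdot_ge0.
  - exact/measurable_EFinP.
  apply: (@le_trans _ _ ((4%:R ^+ a)%:E * (16%:R^-1 ^+ a)%:E)%E).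
    by apply: lee_wpmul2l; [rewrite lee_fin exprn_ge0|exact: cauchy].
  rewrite -EFinM lee_fin -exprMn addn1 expnS natrM invfM mulrA divff// mul1r.
  rewrite natrX -exprVn; apply: lerXn2r; rewrite ?nnegrE//; lra.
have sumfin : (\int[mu]_(x in D) (\sum_(a <oo) f a x) < +oo)%E.
  rewrite integral_nneseries//.
  apply: (@le_lt_trans _ _ (\sum_(a <oo) (2 / (2 ^ (a + 0.+1))%:R)%:E)%E).
    apply: lee_nneseries => [a _ _|a _]; last exact: intf.
    by apply: integral_ge0 => x; exact: f0.
  have cvs := @cvg_geometric_eseries_half R 2 0.
  by rewrite (_ : (\sum_(a <oo) _)%E = (2 / 2 ^+ 0)%:E) ?ltry//; exact: cvg_lim cvs.
have good : {ae mu, forall x, D x -> exists K, forall a, 4%:R ^+ a * p a x <= K}.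
  have ifs : mu.-integrable D (fun x => \sum_(a <oo) f a x)%E.
    apply/integrableP; split.
      by apply: (@ge0_emeasurable_sum _ _ _ D f xpredT) => // a x Dx _; exact: f0.
    rewrite (le_lt_trans _ sumfin)//.
    under eq_integral => x /[!inE] Dx.
      rewrite gee0_abs; last by apply: nneseries_ge0 => a _ _; exact: f0.
      over.
    by [].
  have := integrable_ae mD ifs; apply: filterS => x H Dx.
  exists (fine (\sum_(a <oo) f a x)) => a.
  rewrite -lee_fin fineK; last exact: H.
  apply: le_trans (nneseries_lim_ge a.+1 _) => //; last first.
    by move=> i _ _; exact: f0.
  by rewrite big_nat_recr//= leeDr//; apply: sume_ge0 => i _; exact: f0.
(* The upper limit is defined and measurable everywhere and agrees with the limit where that exists;
   [fine] sends an infinite value to 0. *)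
pose Y x : 'M[R]_(n, m) :=
  \matrix_(i, j) fine (limn_esup (fun a => ((A x *m V a x) i j)%:E)).
have mY : mx_measurable D Y.
  move=> i j; under eq_fun do rewrite mxE.
  apply: (measurableT_comp (f := fine)) => //.
  apply: measurable_fun_limn_esup => a; apply/measurable_EFinP.
  by apply: (mx_measurable_mul mA).
have cvY : {ae mu, forall x, D x -> mx_cvg (fun a => A x *m V a x) (Y x)}.
  apply: filterS good => x H Dx i j; have [K pK] := H Dx.
  rewrite mxE.
  have cz : cvg ((A x *m V a x) i j @[a --> \oo]).
    apply: (@cvg_of_summable_squares _ _ (p ^~ x) (A x i i) K) => //.
      exact: psdmx_diag_ge0.
    move=> a; apply: le_trans (psdmx_entry_sqr (Apsd x) (V a x - V a.+1 x) i j).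
    by rewrite mulmxBr !mxE -sqrrN opprB.
  suff -> : limn_esup (fun a => ((A x *m V a x) i j)%:E) =
      (limn (fun a => (A x *m V a x) i j))%:E by [].
  have cE : (fun a => ((A x *m V a x) i j)%:E) @ \oo -->
      (limn (fun a => (A x *m V a x) i j))%:E by exact: cvg_EFin_seq.
  by rewrite is_cvg_limn_esupE; [apply/cvg_lim|apply/cvg_ex; eexists; exact: cE].
pose W x := mpinv (A x) *m Y x.
have mW : mx_measurable D W.
  by apply: mx_measurable_mul => //; exact: mx_measurable_mpinv.
exists W => // a.
have lim_ae : {ae mu, forall x, D x ->
    (wdot (W \- V a) (W \- V a) x)%:E =
    limn_einf (fun b => (wdot (V a \- V (a + b)%N) (V a \- V (a + b)%N) x)%:E)}.
  apply: filterS cvY => x H Dx.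
  have ZY := H Dx; set Z := fun b => A x *m V b x in ZY.
  have [symA _] := Apsd x; have [AAA _ _ _] := mpinvP (A x).
  (* A A^+ fixes each A V_a, hence also their limit Y. *)
  have AW : A x *m W x = Y x.
    apply: (mx_cvg_unique _ ZY); rewrite /W mulmxA.
    have := mx_cvg_mull (B := A x *m mpinv (A x)) ZY.
    by rewrite /Z; under eq_fun do rewrite mulmxA AAA.
  have wE : wdot (W \- V a) (W \- V a) x =
      mxdot (Y x - Z a) (mpinv (A x) *m (Y x - Z a)).
    by rewrite /wdot wdot_rangeE /= mulmxBr AW.
  have wbE b : wdot (V a \- V (a + b)%N) (V a \- V (a + b)%N) x =
      mxdot (Z (a + b)%N - Z a) (mpinv (A x) *m (Z (a + b)%N - Z a)).
    rewrite /wdot wdot_rangeE /= mulmxBr -[A x *m V a x - _]opprB.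
    by rewrite mulmxN mxdotNN.
  have cv : mxdot (Z (a + b)%N - Z a) (mpinv (A x) *m (Z (a + b)%N - Z a))
      @[b --> \oo] --> mxdot (Y x - Z a) (mpinv (A x) *m (Y x - Z a)).
    have shift : mx_cvg (fun b => Z (a + b)%N) (Y x).
      move=> i j; under eq_fun do rewrite addnC.
      by have := ZY i j; rewrite -(cvg_shiftn a).
    have sb := mx_cvgBr (B := Z a) shift.
    exact: (cvg_mxdot sb (mx_cvg_mull (B := mpinv (A x)) sb)).
  rewrite wE; under eq_fun do rewrite wbE.
  have cE := cvg_EFin_seq cv.
  by rewrite is_cvg_limn_einfE; [apply/esym/cvg_lim|apply/cvg_ex; eexists; exact: cE].
have mwb b : measurable_fun D
    (fun x => (wdot (V a \- V (a + b)%N) (V a \- V (a + b)%N) x)%:E).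
  by apply/measurable_EFinP; exact: measurable_wdot.
rewrite (@ae_eq_integral _ _ _ _ _ _ _ mD _ _ lim_ae).
- apply: le_trans; first by apply: fatou => // b x _; rewrite lee_fin wdot_ge0.
  by apply: limn_einf_le_bound => b; apply: cauchy; exact: leq_addr.
- by apply/measurable_EFinP; apply: measurable_wdot; exact: mx_measurableB.
- have -> : (fun x => limn_einf (fun b =>
      (wdot (V a \- V (a + b)%N) (V a \- V (a + b)%N) x)%:E)) =
    (fun x => - limn_esup (fun b =>
      - (wdot (V a \- V (a + b)%N) (V a \- V (a + b)%N) x)%:E))%E.
    apply/funext => x; rewrite -limn_einfN; congr limn_einf.
    by apply/funext => b; rewrite /comp oppeK.
  apply: measurableT_comp => //; apply: measurable_fun_limn_esup => b.
  exact: measurableT_comp.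
Qed.

End fixed_width.
End weighted_fields.

(** * Pairs of fields scaled by La1 and La2 *)

Section pair_fields.
Context d (T : measurableType d) (R : realType).
Context (mu : {finite_measure set T -> \bar R}) (D : set T) (mD : measurable D).
Context (n k : nat) (A : T -> 'M[R]_n).
Hypothesis Apsd : forall x, psdmx (A x).
Hypothesis mA : mx_measurable D A.
Variables (La1 : 'M[R]_k) (La2 : 'M[R]_n).
Hypothesis La2_unit : La2 \in unitmx.

Local Notation field := (T -> 'M[R]_(n, k) * 'M[R]_n)%type.
Implicit Types v w : field.

(* Turns the norm of L^2_{G,La} into the unscaled one of fields of width k + n. *)
Definition scaled_field v (x : T) : 'M[R]_(n, k + n) :=
  row_mx ((v x).1 *m mpinv La1) ((v x).2 *m invmx La2).

Definition field_mem v : Prop :=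
  [/\ mx_measurable D (fun x => (v x).1), mx_measurable D (fun x => (v x).2) &
      mu.-integrable D (EFin \o wdot A (scaled_field v) (scaled_field v))].

Definition field_dot v w : R :=
  (\int[mu]_(x in D) wdot A (scaled_field v) (scaled_field w) x)%R.

Lemma mx_measurable_row_mx m p q (F : T -> 'M[R]_(m, p)) (G : T -> 'M[R]_(m, q)) :
  mx_measurable D F -> mx_measurable D G ->
  mx_measurable D (fun x => row_mx (F x) (G x)).
Proof.
move=> mF mG i j; under eq_fun do rewrite mxE.
by case: (fintype.split j) => l; [exact: mF|exact: mG].
Qed.

Lemma scaled_field_measurable v : mx_measurable D (fun x => (v x).1) ->
  mx_measurable D (fun x => (v x).2) -> mx_measurable D (scaled_field v).
Proof.
move=> m1 m2; apply: mx_measurable_row_mx;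
by apply: mx_measurable_mul => //; exact: mx_measurable_cst.
Qed.

Lemma scaled_field_sq_integrable v : field_mem v -> sq_integrable mu D A (scaled_field v).
Proof. by move=> [m1 m2 iv]; split => //; exact: scaled_field_measurable. Qed.

Lemma scaled_fieldD c v w x :
  scaled_field (v + c *: w) x = scaled_field v x + c *: scaled_field w x.
Proof.
by rewrite /scaled_field scale_row_mx add_row_mx !scalemxAl -!mulmxDl.
Qed.

Lemma scaled_fieldB v w x :
  scaled_field (v - w) x = scaled_field v x - scaled_field w x.
Proof. by rewrite -scaleN1r scaled_fieldD scaleN1r. Qed.

Lemma wdot_scaled_field v w x :
  wdot A (scaled_field v) (scaled_field w) x =
  mxdot ((v x).1 *m mpinv La1) (A x *m ((w x).1 *m mpinv La1)) +
  mxdot ((v x).2 *m invmx La2) (A x *m ((w x).2 *m invmx La2)).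
Proof. by rewrite /wdot /mxdot mul_mx_row tr_row_mx mul_col_row mxtrace_block. Qed.

Lemma field_dot_integrable v w : field_mem v -> field_mem w ->
  mu.-integrable D (EFin \o wdot A (scaled_field v) (scaled_field w)).
Proof.
by move=> Lv Lw; apply: wdot_integrable => //; exact: scaled_field_sq_integrable.
Qed.

Lemma field_mem_lin c v w : field_mem v -> field_mem w -> field_mem (v + c *: w).
Proof.
move=> Lv Lw; have [v1 v2 _] := Lv; have [w1 w2 _] := Lw; split.
- by apply: mx_measurableD => //; apply: (mx_measurableZ (f := fun=> c)).
- by apply: mx_measurableD => //; apply: (mx_measurableZ (f := fun=> c)).
- have [_] := sq_integrableD mD Apsd mA c (scaled_field_sq_integrable Lv)
    (scaled_field_sq_integrable Lw).
  by rewrite /wdot; under eq_fun do rewrite -scaled_fieldD.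
Qed.

Lemma field_dot_sym v w : field_mem v -> field_mem w -> field_dot v w = field_dot w v.
Proof.
move=> _ _; apply: eq_Rintegral => x _; rewrite /wdot.
exact: psdmx_mxdot_sym.
Qed.

Lemma field_dot_lin c u v w : field_mem u -> field_mem v -> field_mem w ->
  field_dot (u + c *: v) w = field_dot u w + c * field_dot v w.
Proof.
move=> Lu Lv Lw.
have iuw := field_dot_integrable Lu Lw; have ivw := field_dot_integrable Lv Lw.
rewrite /field_dot -RintegralZl// -RintegralD//; last first.
  exact: (integrableZl mD c ivw).
by apply: eq_Rintegral => x _; rewrite /wdot scaled_fieldD mxdotDl mxdotZl.
Qed.

Lemma field_dot_ge0 v : field_mem v -> 0 <= field_dot v v.
Proof. by move=> _; apply: Rintegral_ge0 => x _; exact: wdot_ge0. Qed.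

Lemma field_dotE v w : field_mem v -> field_mem w ->
  (\int[mu]_(x in D) (wdot A (scaled_field v) (scaled_field w) x)%:E =
   (field_dot v w)%:E)%E.
Proof.
move=> Lv Lw; rewrite /field_dot /Rintegral fineK//.
exact: (integrable_fin_num _ (field_dot_integrable Lv Lw)).
Qed.

(** Y P and Y (1 - P) are orthogonal for the weight X: P acts on the right as a symmetric
    idempotent, X on the left. *)
Lemma psdmx_contract (X : 'M[R]_n) (P : 'M[R]_k) (Y : 'M[R]_(n, k)) : psdmx X ->
  P^T = P -> P *m P = P -> mxdot (Y *m P) (X *m (Y *m P)) <= mxdot Y (X *m Y).
Proof.
move=> Xpsd symP idP.
have {3 4}-> : Y = Y *m P + 1 *: (Y *m (1%:M - P)).
  by rewrite scale1r -mulmxDr addrC subrK mulmx1.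
rewrite psdmx_mxdot_expand// -addrA lerDl [X in mxdot _ X]mulmxA mxdot_mulr.
rewrite linearB /= symP trmx1 -[_ *m P *m _]mulmxA mulmxBr mulmx1 idP subrr mulmx0.
rewrite {1}/mxdot trmx0 mul0mx mxtrace0 mulr0 add0r expr1n mul1r.
exact: psdmx_mxdot_ge0.
Qed.

Lemma field_complete (u : nat -> field) : (forall m, field_mem (u m)) ->
  (forall m j, (m <= j)%N -> field_dot (u m - u j) (u m - u j) <= 16%:R^-1 ^+ m) ->
  exists2 v, field_mem v & forall m, field_dot (v - u m) (v - u m) <= 16%:R^-1 ^+ m.
Proof.
move=> Lu cauchy.
have LB v w : field_mem v -> field_mem w -> field_mem (v - w).
  by move=> Lv Lw; rewrite -scaleN1r; exact: field_mem_lin.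
have cauchyS a b : (a <= b)%N ->
    (\int[mu]_(x in D) (wdot A (scaled_field (u a) \- scaled_field (u b))
        (scaled_field (u a) \- scaled_field (u b)) x)%:E
      <= (16%:R^-1 ^+ a)%:E)%E.
  have Lab := LB _ _ (Lu a) (Lu b).
  move=> /cauchy; rewrite -lee_fin -(field_dotE Lab Lab).
  by rewrite /wdot; under eq_integral do rewrite scaled_fieldB.
have [W mW Wu] := sq_integrable_complete mD Apsd mA
    (fun a => scaled_field_sq_integrable (Lu a)) cauchyS.
(* The first block of the limit W need not have the form u La1^+. Scaling v turns that block into
   its product with P, which fixes the first blocks of the scaled u m, so the distances to them do
   not increase. *)
pose v : field := fun x => (lsubmx (W x) *m La1, rsubmx (W x) *m La2).
have [_ LLL symP _] := mpinvP La1; set P := La1 *m mpinv La1 in symP.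
have idP : P *m P = P by rewrite /P -mulmxA (mulmxA (mpinv La1)) LLL.
have v1 : mx_measurable D (fun x => (v x).1).
  apply: mx_measurable_mul; last exact: mx_measurable_cst.
  by move=> i j; under eq_fun do rewrite mxE; exact: mW.
have v2 : mx_measurable D (fun x => (v x).2).
  apply: mx_measurable_mul; last exact: mx_measurable_cst.
  by move=> i j; under eq_fun do rewrite mxE; exact: mW.
have le_wdot m x : wdot A (scaled_field (v - u m)) (scaled_field (v - u m)) x <=
    wdot A (W \- scaled_field (u m)) (W \- scaled_field (u m)) x.
  rewrite wdot_scaled_field /= mulmxBl (mulmxBl (_ *m La2)) -!mulmxA mulmxV// mulmx1.
  rewrite -/P -{1 2}LLL !(mulmxA (u m x).1) -mulmxA -/P -mulmxBl.
  rewrite /wdot /= -[W x]hsubmxK /scaled_field opp_row_mx add_row_mx.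
  rewrite /mxdot mul_mx_row tr_row_mx mul_col_row mxtrace_block -!/(mxdot _ _).
  by rewrite row_mxKl row_mxKr lerD2r; exact: psdmx_contract.
have Wfin m : (\int[mu]_(x in D)
    (wdot A (scaled_field (v - u m)) (scaled_field (v - u m)) x)%:E <=
    (16%:R^-1 ^+ m)%:E)%E.
  have mS := (scaled_field_sq_integrable (Lu m)).1.
  have mSB : mx_measurable D (scaled_field (v - u m)).
    have [m1 m2 _] := Lu m.
    by apply: scaled_field_measurable; exact: mx_measurableB.
  apply: le_trans (Wu m); apply: ge0_le_integral => //.
  - by move=> x _; rewrite lee_fin wdot_ge0.
  - by apply/measurable_EFinP; exact: measurable_wdot.
  - apply/measurable_EFinP; apply: measurable_wdot => //; exact: mx_measurableB.
  - by move=> x _; rewrite lee_fin.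
have LvB m : field_mem (v - u m).
  have [m1 m2 _] := Lu m; split; [exact: mx_measurableB..|].
  have mSB : mx_measurable D (scaled_field (v - u m)).
    by apply: scaled_field_measurable; exact: mx_measurableB.
  apply/integrableP; split; first by apply/measurable_EFinP; exact: measurable_wdot.
  under eq_integral do rewrite /= ger0_norm ?wdot_ge0//.
  by apply: le_lt_trans (Wfin m) _; rewrite ltry.
exists v.
  (* Square integrability has been obtained for the differences v - u m, so v is recovered from one
     of them. *)
  have -> : v = (v - u 0%N) + 1 *: u 0%N by rewrite scale1r subrK.
  exact: field_mem_lin.
by move=> m; rewrite -lee_fin -field_dotE.
Qed.

End pair_fields.

(** * Continuous fields and test functions *)

Section regular_fields.
Context d (T : measurableType d) (R : realType) (K : set T).

(** Enough for a test field to be paired with any finite measure, and stable under linear maps with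
    constant coefficients. *)
Definition mx_regular m p (F : T -> 'M[R]_(m, p)) :=
  mx_measurable K F /\ exists M, forall x i j, K x -> `|F x i j| <= M.

Lemma mx_regularD m p (F G : T -> 'M[R]_(m, p)) :
  mx_regular F -> mx_regular G -> mx_regular (fun x => F x + G x).
Proof.
move=> [mF [M FM]] [mG [N GN]]; split; first exact: mx_measurableD.
exists (M + N) => x i j Kx; rewrite mxE (le_trans (ler_normD _ _))// lerD//.
  exact: FM.
exact: GN.
Qed.

Lemma mx_regular_sum (I : Type) (r : seq I) m p (F : I -> T -> 'M[R]_(m, p)) :
  (forall i, mx_regular (F i)) -> mx_regular (fun x => \sum_(i <- r) F i x).
Proof.
move=> FR; elim: r => [|i r IH].
  split; first by move=> i j; under eq_fun do rewrite big_nil; exact: measurable_cst.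
  by exists 0 => x i j _; rewrite big_nil mxE normr0.
have -> : (fun x => \sum_(j <- i :: r) F j x) = (fun x => F i x + \sum_(j <- r) F j x).
  by apply/funext => x; rewrite big_cons.
exact: mx_regularD.
Qed.

Lemma mx_regularZ m p m' p' (B : 'M[R]_(m', p')) (F : T -> 'M[R]_(m, p)) i j :
  mx_regular F -> mx_regular (fun x => F x i j *: B).
Proof.
move=> [mF [M FM]]; split.
  by move=> a b; under eq_fun do rewrite mxE; apply: measurable_funM => //; exact: mF.
have [BM BMP] : exists BM, forall a b, `|B a b| <= BM.
  exists (\sum_a \sum_b `|B a b|) => a b.
  rewrite (bigD1 a)//= (bigD1 b)//= -addrA lerDl addr_ge0 ?sumr_ge0// => l _.
  exact: sumr_ge0.
exists (`|M| * BM) => x a b Kx; rewrite mxE normrM ler_pM//.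
by rewrite (le_trans (FM _ _ _ Kx))// ler_norm.
Qed.

Lemma mx_regular_linear m p m' p' (L : {linear 'M[R]_(m, p) -> 'M[R]_(m', p')})
    (F : T -> 'M[R]_(m, p)) :
  mx_regular F -> mx_regular (fun x => L (F x)).
Proof.
move=> FR.
have -> : (fun x => L (F x)) =
    (fun x => \sum_i \sum_j F x i j *: L (delta_mx i j)).
  apply/funext => x; rewrite {1}(matrix_sum_delta (F x)) linear_sum.
  by apply: eq_bigr => i _; rewrite linear_sum; apply: eq_bigr => j _; rewrite linearZ.
by apply: mx_regular_sum => i; apply: mx_regular_sum => j; exact: mx_regularZ.
Qed.

Lemma mx_regular_mulr m p q (F : T -> 'M[R]_(m, p)) (B : 'M[R]_(p, q)) :
  mx_regular F -> mx_regular (fun x => F x *m B).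
Proof. exact: (mx_regular_linear (mulmxr B)). Qed.

Lemma mx_regular_mxdot_integrable (la : {finite_measure set T -> \bar R})
    m p (F Y : T -> 'M[R]_(m, p)) : measurable K -> mx_regular F ->
  (forall i j, la.-integrable K (fun x => (Y x i j)%:E)) ->
  la.-integrable K (fun x => (mxdot (F x) (Y x))%:E).
Proof.
move=> mK [mF [M FM]] iY.
have -> : (fun x => (mxdot (F x) (Y x))%:E) =
    (fun x => \sum_i \sum_j (F x i j * Y x i j)%:E)%E.
  apply/funext => x; rewrite mxdotE -sumEFin; apply: eq_bigr => i _.
  by rewrite -sumEFin.
apply: integrable_sum => // i _; apply: integrable_sum => // j _.
apply: (integrable_mul_bounded mK (mF i j) _ (iY i j)).
by exists M => x Kx; exact: FM.
Qed.

Lemma pairing_sum_Rintegral (la : {finite_measure set T -> \bar R})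
    m p (F Y : T -> 'M[R]_(m, p)) : measurable K -> mx_regular F ->
  (forall i j, la.-integrable K (fun x => (Y x i j)%:E)) ->
  \sum_i \sum_j (\int[la]_(x in K) (F x i j * Y x i j))%R =
  (\int[la]_(x in K) mxdot (F x) (Y x))%R.
Proof.
move=> mK [mF [M FM]] iY.
have iFY i j : la.-integrable K (EFin \o (fun x => F x i j * Y x i j)).
  apply: (integrable_mul_bounded mK (mF i j) _ (iY i j)).
  by exists M => x Kx; exact: FM.
rewrite /Rintegral; under [in RHS]eq_integral do rewrite mxdotE -sumEFin.
rewrite integral_sum//; last first.
  move=> i; under eq_fun do rewrite -sumEFin.
  by apply: integrable_sum => // j _; exact: iFY.
rewrite -sum_fine; last first.
  move=> i _; under eq_integral do rewrite -sumEFin.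
  apply: integrable_fin_num => //.
  by apply: integrable_sum => // j _; exact: iFY.
apply: eq_bigr => i _; under [in RHS]eq_integral do rewrite -sumEFin.
rewrite integral_sum//; last by move=> j; exact: iFY.
rewrite -sum_fine// => j _.
exact: (integrable_fin_num mK (iFY i j)).
Qed.

End regular_fields.

Section continuous_fields.
Context {R : realType} {X : ptopologicalType} (K : set X).
Hypothesis Kcompact : compact K.
Hypothesis Kclosed : closed K.

Lemma borel_closed : measurable (K : set (borel X)).
Proof.
rewrite -[K]setCK; apply: measurableC; apply: sub_sigma_algebra.
exact: closed_openC.
Qed.

Lemma continuous_within_measurable (f : X -> R) : {within K, continuous f} ->
  measurable_fun (K : set (borel X)) f.
Proof.
move=> /continuousP cf _; apply: (measurability _ (RGenOpens.measurableE R)).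
move=> _ [_ [a [b ->] <-]].
have /open_subspaceP [V oV VK] := cf _ (interval_open (a:=BRight a) (b:=BLeft b) isT isT).
rewrite setIC -VK; apply: measurableI; last exact: borel_closed.
exact: sub_sigma_algebra.
exact: borel_closed.
Qed.

Lemma continuous_within_entry m p (F : X -> 'M[R]_(m, p)) i j :
  {within K, continuous F} -> {within K, continuous (fun x => F x i j)}.
Proof.
move=> cF x.
exact: (cvg_comp _ _ (cF x) (@coord_continuous R m p i j (F x))).
Qed.

Lemma continuous_within_regular m p (F : X -> 'M[R]_(m, p)) :
  {within K, continuous F} -> mx_regular (K : set (borel X)) F.
Proof.
move=> cF; split.
  by move=> i j; apply: continuous_within_measurable; exact: continuous_within_entry.
have bd i j : exists M, forall x, K x -> `|F x i j| <= M.
  have cFij := continuous_within_entry (i := i) (j := j) cF.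
  have [M [_ MP]] := compact_bounded (continuous_compact cFij Kcompact).
  exists (M + 1) => x Kx; apply: (MP (M + 1)); first by rewrite ltrDl.
  by exists x.
have /choice[M MP] : forall ij : 'I_m * 'I_p, exists M, forall x, K x -> `|F x ij.1 ij.2| <= M.
  by move=> [i j]; exact: bd.
exists (\sum_ij `|M ij|) => x i j Kx.
rewrite (le_trans (MP (i, j) x Kx))// (le_trans (ler_norm _))//.
by rewrite (bigD1 (i, j))//= lerDl sumr_ge0.
Qed.

End continuous_fields.

Section C1_functions.
Context {R : realType} {d n : nat} (Q : set (R * 'rV[R]_d)).

(** The record carries proofs, so the combination is described by its values and its chosen
    derivatives instead of an equation between records. *)
Lemma C1fun_lin (c : R) (Phi Psi : C1fun n Q) : exists Xi : C1fun n Q,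
  [/\ forall z, Xi z = Phi z + c *: Psi z,
      forall z, C1dt Xi z = C1dt Phi z + c *: C1dt Psi z &
      forall j z, C1dx Xi j z = C1dx Phi j z + c *: C1dx Psi j z].
Proof.
have clin (F G : R * 'rV[R]_d -> 'M[R]_n) : {within Q, continuous F} ->
    {within Q, continuous G} -> {within Q, continuous (fun z => F z + c *: G z)}.
  by move=> cF cG z; apply: cvgD; [exact: cF|apply: cvgZl_tmp; exact: cG].
unshelve eexists (@MkC1 R d n Q (fun z => Phi z + c *: Psi z)
  (fun z => C1dt Phi z + c *: C1dt Psi z)
  (fun j z => C1dx Phi j z + c *: C1dx Psi j z) _ _ _ _ _ _).
- by move=> z Qz; rewrite linearD linearZ /= !C1_sym.
- by apply: clin; exact: C1_cont.
- by apply: clin; exact: C1dt_cont.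
- by move=> j; apply: clin; exact: C1dx_cont.
- by move=> z Qz; apply: is_deriveD; [|apply: is_deriveZ]; exact: C1dtP.
- by move=> j z Qz; apply: is_deriveD; [|apply: is_deriveZ]; exact: C1dxP.
- by split.
Qed.

Lemma C1fun_exists : exists Phi : C1fun n Q, forall z, Phi z = 0.
Proof.
have c0 : {within Q, continuous (fun=> 0 : 'M[R]_n)} by move=> z; exact: cvg_cst.
unshelve eexists (@MkC1 R d n Q (fun=> 0) (fun=> 0) (fun _ _ => 0) _ _ _ _ _ _) => //.
- by move=> z Qz; rewrite trmx0.
Qed.

End C1_functions.

Section spacetime_domain.
Context {R : realType} {d : nat} (Omega : set 'rV[R]_d) (Omega_compact : compact Omega).

Lemma spacetime_compact : compact (spacetime Omega).
Proof. by apply: compact_setX => //; exact: segment_compact. Qed.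

Lemma spacetime_closed : closed (spacetime Omega).
Proof. by apply: compact_closed spacetime_compact; exact: norm_hausdorff. Qed.

End spacetime_domain.

(** * The action density *)

Section action_density.
Context {R : realType} {n k : nat} (La1 : 'M[R]_k) (La2 : 'M[R]_n).
Hypothesis La1_sym : La1^T = La1.
Hypothesis La2_sym : La2^T = La2.
Hypothesis La2_unit : La2 \in unitmx.

Local Notation pair := ('M[R]_(n, k) * 'M[R]_n)%type.

Definition pair_form (X : 'M[R]_n) (w v : pair) : R :=
  mxdot (w.1 *m mpinv La1) (X *m (v.1 *m mpinv La1)) +
  mxdot (w.2 *m invmx La2) (X *m (v.2 *m invmx La2)).

Lemma pair_formZ c X w v : pair_form (c *: X) w v = c * pair_form X w v.
Proof. by rewrite /pair_form -!scalemxAl !mxdotZr mulrDr. Qed.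

(** The range conditions become fixed-point equations of the projectors X X^+ and La1^+ La1:
    equalities between measurable matrix functions, hence Borel conditions. *)
Definition action_ok (X : 'M[R]_n) (Y : 'M[R]_(n, k)) (Z : 'M[R]_n) :=
  [/\ psdmx X, Y *m (mpinv La1 *m La1) = Y, X *m mpinv X *m Y = Y &
      X *m mpinv X *m Z = Z].

Lemma action_okP X Y Z :
  [/\ psdmx X, ran_sub Y^T La1 & ran_sub (row_mx Y Z) X] <-> action_ok X Y Z.
Proof.
split=> [[Xpsd YLa /ran_sub_row_mx[YX ZX]]|[Xpsd YLa YX ZX]]; split=> //.
- have := mul_mpinv_ran YLa; move=> /(congr1 trmx); rewrite trmxK trmx_mul trmxK.
  by rewrite trmx_mul La1_sym mpinv_sym.
- exact: mul_mpinv_ran.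
- exact: mul_mpinv_ran.
- by rewrite -YLa mulmxA trmx_mul La1_sym; exact: ran_sub_mulmx.
- apply/ran_sub_row_mx; split; first by rewrite -YX -mulmxA; exact: ran_sub_mulmx.
  by rewrite -ZX -mulmxA; exact: ran_sub_mulmx.
Qed.

Lemma mpinv_La1 : mpinv La1 *m La1 *m mpinv La1 = mpinv La1.
Proof. by have [_ ->] := mpinvP La1. Qed.

Lemma action_ok_momentum X (v : pair) : psdmx X ->
  action_ok X (X *m v.1 *m (mpinv La1 *m La1)) (X *m v.2).
Proof.
move=> Xpsd; have [XXX _ _ _] := mpinvP X; split => //.
- by rewrite -!mulmxA; congr (_ *m (_ *m _)); rewrite !mulmxA mpinv_La1.
- by rewrite !mulmxA XXX.
- by rewrite !mulmxA XXX.
Qed.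

(** X X^+ X = X removes the inverse from momenta of the form X V, leaving the kinetic energy of the
    velocity; La1^+ La1 La1^+ = La1^+ absorbs the projector. *)
Lemma Jdensity_momentum X (v : pair) : psdmx X ->
  Jdensity La1 La2 X (X *m v.1 *m (mpinv La1 *m La1)) (X *m v.2) =
  (2^-1 * pair_form X v v)%:E.
Proof.
move=> Xpsd; have ok := action_ok_momentum v Xpsd.
have [XXX _ _ _] := mpinvP X; have [Xsym _] := Xpsd.
rewrite /Jdensity asboolT; last exact/action_okP.
have XLa : X *m v.1 *m (mpinv La1 *m La1) *m mpinv La1 = X *m (v.1 *m mpinv La1).
  by rewrite -!mulmxA; congr (_ *m (_ *m _)); rewrite mulmxA mpinv_La1.
have dual m (V : 'M[R]_(n, m)) :
    mxdot (X *m V) (mpinv X *m (X *m V)) = mxdot V (X *m V).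
  by rewrite -{1}Xsym -mxdot_mull !mulmxA XXX.
rewrite -(mulmxA (mpinv X)) XLa dual -!(mulmxA (mpinv X)).
by rewrite -[X *m v.2 *m _]mulmxA dual mulrDr.
Qed.

Lemma Jdensity_ge0 X Y Z : (0 <= Jdensity La1 La2 X Y Z)%E.
Proof.
rewrite /Jdensity; case: asboolP => // /action_okP[Xpsd YLa YX ZX].
(* Every admissible pair is the momentum of its own velocity (X^+ Y, X^+ Z). *)
have -> : Y = X *m (mpinv X *m Y) *m (mpinv La1 *m La1) by rewrite (mulmxA X) YX YLa.
have -> : Z = X *m (mpinv X *m Z) by rewrite (mulmxA X) ZX.
have := Jdensity_momentum (mpinv X *m Y, mpinv X *m Z) Xpsd.
rewrite /Jdensity asboolT; last exact/action_okP/action_ok_momentum.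
move=> ->; rewrite lee_fin mulr_ge0// addr_ge0//; exact: psdmx_mxdot_ge0.
Qed.

(** This is why Pi carries squares: each side of the weighted product contributes one inverse
    factor, and the square cancels both. For La2 nothing remains; for La1, possibly singular, the
    projector La1^+ La1 does. *)
Lemma pair_form_Pi X (v : pair) (F : 'M[R]_(n, k)) (Phi : 'M[R]_n) :
  pair_form X (F *m (La1 *m La1), Phi *m (La2 *m La2)) v =
  mxdot F (X *m v.1 *m (mpinv La1 *m La1)) + mxdot Phi (X *m v.2).
Proof.
have symL := mpinv_sym La1_sym; have comm := mpinv_comm La1_sym.
rewrite /pair_form /=; congr (_ + _).
  rewrite -mulmxA -[in LHS](trmxK (La1 *m La1 *m mpinv La1)) -mxdot_mulr.
  rewrite !trmx_mul symL La1_sym; congr mxdot; rewrite !mulmxA; congr (_ *m _).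
  rewrite -[in LHS]mulmxA comm -!mulmxA; congr (_ *m (_ *m _)).
  by rewrite mulmxA mpinv_La1.
rewrite -mulmxA -[La2 *m La2 *m _]mulmxA mulmxV// mulmx1.
have -> B : mxdot (Phi *m La2) B = mxdot Phi (B *m La2) by rewrite mxdot_mulr La2_sym.
by rewrite -!mulmxA mulVmx// mulmx1.
Qed.

End action_density.

(** * Measurability of the action density *)

Section measurable_action.
Context {R : realType} d (T : measurableType d) (D : set T) (mD : measurable D).

Lemma measurable_zero_set (f : T -> R) : measurable_fun D f ->
  measurable (D `&` [set x | f x = 0]).
Proof. by move=> mf; exact: (mf mD [set 0] (measurable_set1 _)). Qed.

Lemma measurable_eqmx m p (F G : T -> 'M[R]_(m, p)) :
  mx_measurable D F -> mx_measurable D G -> measurable (D `&` [set x | F x = G x]).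
Proof.
move=> mF mG; have mFG : mx_measurable D (fun x => F x - G x) by exact: mx_measurableB.
have -> : [set x | F x = G x] = [set x | mxdot (F x - G x) (F x - G x) = 0].
  apply/seteqP; split=> x /= => [->|/mxdot_eq0/eqP].
    by rewrite subrr /mxdot mulmx0 mxtrace0.
  by rewrite subr_eq0 => /eqP.
by apply: measurable_zero_set; exact: measurable_mxdot.
Qed.

(* Countably many conditions, by homogeneity of the quadratic form: the positive
   semidefinite cone is Borel. *)
Lemma psdmx_intP n (X : 'M[R]_n) : psdmx X <->
  X^T = X /\ forall z : 'cV[int]_n, 0 <= mxdot (map_mx intr z) (X *m map_mx intr z).
Proof.
split=> [Xpsd|[symX Xz]].
  by split; [case: Xpsd|move=> z; exact: psdmx_mxdot_ge0].
split=> // x.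
have -> : (x^T *m X *m x) 0 0 = mxdot x (X *m x).
  by rewrite /mxdot mulmxA /mxtrace big_ord_recl big_ord0 addr0.
(* x rounded down to the grid of mesh 1 / (a + 1); homogeneity removes the denominator. *)
pose y (a : nat) : 'cV[R]_n :=
  a.+1%:R^-1 *: map_mx intr (\col_i Num.floor (a.+1%:R * x i 0)).
have y0 a : 0 <= mxdot (y a) (X *m y a).
  rewrite /y -scalemxAr mxdotZl mxdotZr !mulr_ge0 ?invr_ge0//.
have yx : mx_cvg y x.
  move=> i j; rewrite (ord1 j).
  apply: (@squeeze_cvgr _ _ _ _ (fun a : nat => x i 0 - a.+1%:R^-1) (cst (x i 0))).
  - apply: nearW => a; rewrite /y !mxE /=.
    have a0 : (0 : R) < a.+1%:R by rewrite ltr0n.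
    have := ge_floor (a.+1%:R * x i 0); have := floorD1_gt (a.+1%:R * x i 0).
    rewrite intrD; set fl := (Num.floor _)%:~R => lo hi.
    rewrite mulrC ler_pdivlMr// ler_pdivrMr// mulrBl mulVf ?gt_eqF//.
    by rewrite (mulrC (x i 0)) hi andbT lerBlDr ltW.
  - rewrite -[X in _ --> X]subr0; apply: cvgB; [exact: cvg_cst|exact: cvg_harmonic].
  - exact: cvg_cst.
have cv := cvg_mxdot yx (mx_cvg_mull (B := X) yx).
rewrite -(cvg_lim _ cv)//; apply: limr_ge; first by apply/cvg_ex; eexists; exact: cv.
exact: nearW.
Qed.

Lemma measurable_psdmx n (F : T -> 'M[R]_n) : mx_measurable D F ->
  measurable (D `&` [set x | psdmx (F x)]).
Proof.
move=> mF.
(* Integer vectors are enumerated by their codes; a number that codes none gives a condition that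
   always holds. *)
pose P (a : nat) x := if unpickle a is Some z then
  0 <= mxdot (map_mx intr (z : 'cV[int]_n)) (F x *m map_mx intr z) else true.
have -> : D `&` [set x | psdmx (F x)] =
    (D `&` [set x | (F x)^T = F x]) `&` \bigcap_a (D `&` [set x | P a x]).
  apply/seteqP; split=> [x [Dx /psdmx_intP[symF Fz]]|x [[Dx symF] Fz]].
    by split=> // a _; split=> //=; rewrite /P; case: unpickle.
  split=> //; apply/psdmx_intP; split=> // z.
  by have [_] := Fz (pickle z) I; rewrite /= /P pickleK.
apply: measurableI; first by apply: measurable_eqmx => //; exact: mx_measurable_tr.
apply: bigcapT_measurable => a; rewrite /P; case: unpickle => [z|].
  have mz : measurable_fun D
      (fun x => mxdot (map_mx intr z : 'cV[R]_n) (F x *m map_mx intr z)).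
    apply: measurable_mxdot; first exact: mx_measurable_cst.
    by apply: mx_measurable_mul => //; exact: mx_measurable_cst.
  have := mz mD `[0, +oo[%classic (measurable_itv _).
  congr measurable; apply/seteqP; split=> x /= [Dx]; rewrite in_itv /= andbT//.
by rewrite (_ : [set _ | true] = setT) ?setIT//; apply/seteqP; split.
Qed.

Section action.
Context {n k : nat} (La1 : 'M[R]_k) (La2 : 'M[R]_n).
Hypothesis La1_sym : La1^T = La1.
Context (X : T -> 'M[R]_n) (Y : T -> 'M[R]_(n, k)) (Z : T -> 'M[R]_n).
Hypotheses (mX : mx_measurable D X) (mY : mx_measurable D Y) (mZ : mx_measurable D Z).

Lemma measurable_action_ok :
  measurable (D `&` [set x | action_ok La1 (X x) (Y x) (Z x)]).
Proof.
have mXX : mx_measurable D (fun x => X x *m mpinv (X x)).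
  by apply: mx_measurable_mul => //; exact: mx_measurable_mpinv.
have -> : D `&` [set x | action_ok La1 (X x) (Y x) (Z x)] =
  (D `&` [set x | psdmx (X x)]) `&`
  ((D `&` [set x | Y x *m (mpinv La1 *m La1) = Y x]) `&`
  ((D `&` [set x | X x *m mpinv (X x) *m Y x = Y x]) `&`
   (D `&` [set x | X x *m mpinv (X x) *m Z x = Z x]))).
  by apply/seteqP; split=> [x [Dx []]//|x [[Dx ?] [[_ ?] [[_ ?] [_ ?]]]]]; split.
apply: measurableI; first exact: measurable_psdmx.
apply: measurableI.
  apply: measurable_eqmx => //.
  by apply: mx_measurable_mul => //; exact: mx_measurable_cst.
by apply: measurableI; apply: measurable_eqmx => //; exact: mx_measurable_mul.
Qed.

Lemma measurable_Jdensity :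
  measurable_fun D (fun x => Jdensity La1 La2 (X x) (Y x) (Z x)).
Proof.
pose b x := `[< [/\ psdmx (X x), ran_sub (Y x)^T La1 &
  ran_sub (row_mx (Y x) (Z x)) (X x)] >].
have bE : D `&` b @^-1` [set true] = D `&` [set x | action_ok La1 (X x) (Y x) (Z x)].
  apply/seteqP; split=> x /= [Dx].
    by rewrite /b => /asboolP/(action_okP La1_sym).
  by move=> /(action_okP La1_sym) ?; split => //; apply/asboolP.
have mb : measurable_fun D b.
  by apply: (measurable_fun_bool true); rewrite bE; exact: measurable_action_ok.
have mXi : mx_measurable D (fun x => mpinv (X x)) by exact: mx_measurable_mpinv.
rewrite /Jdensity; apply: (measurable_fun_if mD mb); last exact: measurable_cst.
apply/measurable_EFinP; apply: (@measurable_funS _ _ _ _ D) => //.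
have mc m p (B : 'M[R]_(m, p)) : mx_measurable D (fun _ : T => B) by exact: mx_measurable_cst.
apply: measurable_funD; apply: measurable_funM => //; apply: measurable_mxdot;
do ?apply: mx_measurable_mul => //.
Qed.

(** The density is nonnegative and infinite wherever a constraint fails, so a finite integral
    confines failure to a null set. *)
Lemma action_ok_ae (la : {measure set T -> \bar R}) :
  (\int[la]_(x in D) Jdensity La1 La2 (X x) (Y x) (Z x) < +oo)%E ->
  {ae la, forall x, D x -> action_ok La1 (X x) (Y x) (Z x)}.
Proof.
move=> fin.
have int : la.-integrable D (fun x => Jdensity La1 La2 (X x) (Y x) (Z x)).
  apply/integrableP; split; first exact: measurable_Jdensity.
  by under eq_integral do rewrite gee0_abs ?Jdensity_ge0//.
have := integrable_ae mD int; apply: filterS => x H Dx.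
have := H Dx; rewrite /Jdensity; case: asboolP => // ok _.
exact/(action_okP La1_sym).
Qed.

End action.
End measurable_action.

(** * Reference measures *)

Section integrable_matrices.
Context d (T : measurableType d) (R : realType).
Context (mu : {finite_measure set T -> \bar R}) (D : set T) (mD : measurable D).

Lemma mx_integrable_mulr m p q (Y : T -> 'M[R]_(m, p)) (B : 'M[R]_(p, q)) :
  (forall i j, mu.-integrable D (fun x => (Y x i j)%:E)) ->
  forall i j, mu.-integrable D (fun x => ((Y x *m B) i j)%:E).
Proof.
move=> iY i j.
have -> : (fun x => ((Y x *m B) i j)%:E) =
    (fun x => \sum_l (B l j)%:E * (Y x i l)%:E)%E.
  apply/funext => x; rewrite mxE -sumEFin; apply: eq_bigr => l _.
  by rewrite -EFinM mulrC.
by apply: integrable_sum => // l _; apply: integrableZl.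
Qed.

(** V may be unbounded where A degenerates, but (A V)_ij^2 <= A_ii (V . A V) dominates A V by an
    integrable function. This makes the momenta of a square integrable velocity finite measures. *)
Lemma sq_integrable_weight n m (A : T -> 'M[R]_n) (V : T -> 'M[R]_(n, m)) :
  (forall x, psdmx (A x)) -> mx_measurable D A ->
  (forall i j, mu.-integrable D (fun x => (A x i j)%:E)) ->
  sq_integrable mu D A V ->
  forall i j, mu.-integrable D (fun x => ((A x *m V x) i j)%:E).
Proof.
move=> Apsd mA iA [mV iV] i j.
apply: (@le_integrable _ _ _ _ _ mD _ (EFin \o (fun x => A x i i + wdot A V V x))).
- by apply/measurable_EFinP; exact: mx_measurable_mul.
- move=> x Dx /=; rewrite lee_fin.
  have A0 := psdmx_diag_ge0 (Apsd x) i; have V0 := wdot_ge0 Apsd V x.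
  have := psdmx_entry_sqr (Apsd x) (V x) i j; rewrite -/(wdot A V V x) => AV.
  rewrite (ger0_norm (addr_ge0 _ _))//.
  by apply: normr_le_of_sqr; [exact: addr_ge0|nra].
- have -> : EFin \o (fun x => A x i i + wdot A V V x) =
    ((fun x => (A x i i)%:E) \+ (EFin \o wdot A V V))%E by [].
  exact: integrableD.
Qed.

Lemma wdot_regular_integrable n m (A : T -> 'M[R]_n) (F : T -> 'M[R]_(n, m)) :
  mx_measurable D A -> (forall i j, mu.-integrable D (fun x => (A x i j)%:E)) ->
  mx_regular D F -> mu.-integrable D (EFin \o wdot A F F).
Proof.
move=> mA iA FR; apply: (mx_regular_mxdot_integrable mD FR) => i j.
have [mF [M FM]] := FR.
have -> : (fun x => ((A x *m F x) i j)%:E) =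
    (fun x => \sum_l (F x l j * A x i l)%:E)%E.
  apply/funext => x; rewrite mxE -sumEFin; apply: eq_bigr => l _.
  by rewrite mulrC.
apply: integrable_sum => // l _.
apply: (integrable_mul_bounded mD (mF l j) _ (iA i l)).
by exists M => x Kx; exact: FM.
Qed.

End integrable_matrices.

Section reference_measures.
Context {R : realType} {X : ptopologicalType}.
Local Notation bX := (borel X).
Implicit Types (la : {finite_measure set bX -> \bar R}).

Definition mx_density la m p (M : mxmeas R X m p) (F : bX -> 'M[R]_(m, p)) :=
  forall i j, has_density (M i j) la (fun x => F x i j).

Lemma density_mx_density la m p (M : mxmeas R X m p) :
  (forall i j, M i j `<< la) -> mx_density la M (density la M).
Proof.
move=> dom i j; rewrite /density; under eq_fun do rewrite mxE.
exact: dominates_has_density.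
Qed.

Lemma mx_density_ae la m p (M : mxmeas R X m p) F F' :
  mx_density la M F -> mx_density la M F' -> {ae la, forall x, F x = F' x}.
Proof.
move=> FM FM'.
have H i j : {ae la, forall x, F x i j = F' x i j} := has_density_ae (FM i j) (FM' i j).
have {}H i : {ae la, forall x, forall j, F x i j = F' x i j} by exact: filter_forall.
have {}H : {ae la, forall x, forall i j, F x i j = F' x i j} by exact: filter_forall.
by apply: filterS H => x FF'; apply/matrixP.
Qed.

Lemma mx_density_measurable la m p (M : mxmeas R X m p) F (D : set bX) :
  mx_density la M F -> mx_measurable D F.
Proof.
move=> FM i j; have [iF _] := FM i j; apply: measurable_funTS.
by apply/measurable_EFinP; exact: measurable_int iF.
Qed.

Lemma mx_density_integrable la m p (M : mxmeas R X m p) F (D : set bX) : measurable D ->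
  mx_density la M F -> forall i j, la.-integrable D (fun x => (F x i j)%:E).
Proof.
move=> mD FM i j; have [iF _] := FM i j.
exact: (@integrableS _ _ _ _ setT).
Qed.

Let elt (s : seq ({charge set bX -> \bar R})) i : {charge set bX -> \bar R} :=
  nth (czero : {charge set bX -> \bar R}) s i.

Let dominated_seq s (la : {measure set bX -> \bar R}) :=
  forall i, (i < size s)%N -> elt s i `<< la.

Lemma dominated_entriesP m p (M : mxmeas R X m p) (la : {measure set bX -> \bar R}) :
  dominated_seq (entries M) la <-> forall i j, M i j `<< la.
Proof.
split=> [dom i j|dom l].
  pose l := index (i, j) (enum {: 'I_m * 'I_p}).
  have ll : (l < size (enum {: 'I_m * 'I_p}))%N by rewrite index_mem mem_enum.
  have := dom l; rewrite size_map => /(_ ll).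
  by rewrite /elt /entries (nth_map (i, j))// nth_index// mem_enum.
rewrite size_map => ll; rewrite /elt /entries.
by case: (enum _) ll => // ij s ll; rewrite (nth_map ij)//; exact: dom.
Qed.

Lemma dominated_cat s t la : dominated_seq (s ++ t) la <->
  dominated_seq s la /\ dominated_seq t la.
Proof.
split=> [dom|[ds dt] i].
  split=> i il.
    by have := dom i; rewrite /elt size_cat nth_cat il; apply; rewrite ltn_addr.
  have := dom (size s + i)%N; rewrite /elt size_cat ltn_add2l il nth_cat.
  by rewrite ltnNge leq_addr /= addKn; exact.
rewrite /elt size_cat nth_cat; case: (ltnP i (size s)) => [il _|si il]; first exact: (ds i il).
have il2 : (i - size s < size t)%N by rewrite ltn_subLR.
exact: (dt _ il2).
Qed.

Lemma ref1_dominates n (G : mxmeas R X n n) i j : G i j `<< ref1 G.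
Proof. by move: i j; apply/dominated_entriesP => l; exact: sum_variation_dominates. Qed.

Lemma ref3_dominates n k (G : mxmeas R X n n) (q : mxmeas R X n k) (r : mxmeas R X n n) :
  [/\ forall i j, G i j `<< ref3 G q r, forall i j, q i j `<< ref3 G q r &
      forall i j, r i j `<< ref3 G q r].
Proof.
have : dominated_seq (entries G ++ entries q ++ entries r) (ref3 G q r).
  by move=> l; exact: sum_variation_dominates.
move=> /dominated_cat[dG /dominated_cat[dq dr]].
by split; apply/dominated_entriesP.
Qed.

Lemma ref1_ref3_dominates n k (G : mxmeas R X n n) (q : mxmeas R X n k)
    (r : mxmeas R X n n) : ref1 G `<< ref3 G q r.
Proof.
apply: dominates_sum_variation; apply/dominated_entriesP.
by have [] := ref3_dominates G q r.
Qed.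

Lemma ref1_density n (G : mxmeas R X n n) : mx_density (ref1 G) G (density (ref1 G) G).
Proof. by apply: density_mx_density; exact: ref1_dominates. Qed.

Lemma mx_density_change mu la h m p (M : mxmeas R X m p) F : change_density mu la h ->
  mx_density mu M F -> mx_density la M (fun x => h x *: F x).
Proof.
move=> hP FM i j; under eq_fun do rewrite mxE mulrC.
exact: (change_density_has_density hP).
Qed.

Lemma pairing_density (K : set bX) la m p (M : mxmeas R X m p) (F Y : bX -> 'M[R]_(m, p)) :
  measurable K -> mx_regular K F -> mx_density la M Y ->
  pairing K F M = (\int[la]_(x in K) mxdot (F x) (Y x))%R.
Proof.
move=> mK FR MY; rewrite -(pairing_sum_Rintegral mK FR); last first.
  exact: mx_density_integrable.
have [mF [B FB]] := FR.
apply: eq_bigr => i _; apply: eq_bigr => j _.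
apply: (cpairing_density mK (MY i j) (mF i j)).
by exists B => x Kx; exact: FB.
Qed.

End reference_measures.

(* A is the density of G, modified on a null set so as to be positive
   semidefinite everywhere. *)
Section L2_bridge.
Context {R : realType} {X : ptopologicalType} {n k : nat}.
Local Notation bX := (borel X).
Context (K : set bX) (mK : measurable K) (G : mxmeas R X n n) (A : bX -> 'M[R]_n).
Hypothesis Apsd : forall x, psdmx (A x).
Hypothesis mA : mx_measurable K A.
Hypothesis aeA : {ae ref1 G, forall x, K x -> density (ref1 G) G x = A x}.
Variables (La1 : 'M[R]_k) (La2 : 'M[R]_n).
Local Notation sc := (scaled_field (T := bX) La1 La2).
Local Notation mu := (ref1 G).
Local Notation field := (bX -> 'M[R]_(n, k) * 'M[R]_n)%type.

Lemma L2ip0E m (P P' : bX -> 'M[R]_(n, m)) : mx_measurable K P -> mx_measurable K P' ->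
  L2ip0 K G P P' = (\int[mu]_(x in K) (wdot A P P' x)%:E)%E.
Proof.
move=> mP mP'; apply: ae_eq_integral => //.
- apply/measurable_EFinP; apply: measurable_mxdot => //; apply: mx_measurable_mul => //.
  exact: mx_density_measurable (ref1_density G).
- by apply/measurable_EFinP; exact: measurable_wdot.
- by apply: filterS aeA => x H Kx; rewrite /wdot H.
Qed.

Definition field_measurable (v : field) :=
  mx_measurable K (fun x : bX => (v x).1) /\ mx_measurable K (fun x : bX => (v x).2).

Let block1 (v : field) (x : bX) := (v x).1 *m mpinv La1.
Let block2 (v : field) (x : bX) := (v x).2 *m invmx La2.

Let mblocks v : field_measurable v ->
  mx_measurable K (block1 v) /\ mx_measurable K (block2 v).
Proof.
by move=> [m1 m2]; split; apply: mx_measurable_mul => //; exact: mx_measurable_cst.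
Qed.

Let wdot_blocks (v w : field) x :
  wdot A (sc v) (sc w) x = wdot A (block1 v) (block1 w) x + wdot A (block2 v) (block2 w) x.
Proof. exact: wdot_scaled_field. Qed.

(** Both summands are nonnegative, so the integrals add in the extended reals, infinite values
    included; this is what allows membership to be decided by it. *)
Lemma L2norm2E (v : field) : field_measurable v ->
  L2norm2 La1 La2 K G v = (\int[mu]_(x in K) (wdot A (sc v) (sc v) x)%:E)%E.
Proof.
move=> /mblocks[m1 m2]; rewrite /L2norm2 /L2ip !L2ip0E//.
under [RHS]eq_integral do rewrite wdot_blocks EFinD.
rewrite ge0_integralD//.
- by move=> x _; rewrite lee_fin wdot_ge0.
- by apply/measurable_EFinP; exact: measurable_wdot.
- by move=> x _; rewrite lee_fin wdot_ge0.
- by apply/measurable_EFinP; exact: measurable_wdot.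
Qed.

Lemma L2memP (v : field) : L2mem La1 La2 K G v <-> field_mem (ref1 G) K A La1 La2 v.
Proof.
have normE : (\int[mu]_(x in K) `|(wdot A (sc v) (sc v) x)%:E| =
    \int[mu]_(x in K) (wdot A (sc v) (sc v) x)%:E)%E.
  by under eq_integral do rewrite gee0_abs ?lee_fin ?wdot_ge0//.
split=> [[m1 m2]|[m1 m2 /integrableP[_]]].
  rewrite L2norm2E// => fin; split => //; apply/integrableP; split.
    by apply/measurable_EFinP; apply: measurable_wdot => //; exact: scaled_field_measurable.
  by rewrite normE.
by move=> fin; split => //; rewrite L2norm2E//; rewrite -normE.
Qed.

Let block_sq v : field_mem mu K A La1 La2 v ->
  sq_integrable mu K A (block1 v) /\ sq_integrable mu K A (block2 v).
Proof.
move=> [m1 m2 iv]; have [b1 b2] := mblocks (conj m1 m2).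
split; split => //; apply: (le_integrable mK _ _ iv).
- by apply/measurable_EFinP; exact: measurable_wdot.
- move=> x Kx; rewrite /= lee_fin !ger0_norm ?wdot_ge0// wdot_blocks lerDl.
  exact: wdot_ge0.
- by apply/measurable_EFinP; exact: measurable_wdot.
- move=> x Kx; rewrite /= lee_fin !ger0_norm ?wdot_ge0// wdot_blocks lerDr.
  exact: wdot_ge0.
Qed.

Lemma L2ipE (v w : field) : L2mem La1 La2 K G v -> L2mem La1 La2 K G w ->
  L2ip La1 La2 K G v w = (field_dot mu K A La1 La2 v w)%:E.
Proof.
move=> /L2memP Lv /L2memP Lw; rewrite -field_dotE//.
have [v1 v2] := block_sq Lv; have [w1 w2] := block_sq Lw.
rewrite /L2ip !L2ip0E//; [|exact: v2.1|exact: w2.1|exact: v1.1|exact: w1.1].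
under [RHS]eq_integral do rewrite wdot_blocks EFinD.
by rewrite integralD//; exact: wdot_integrable.
Qed.

End L2_bridge.

(** * Momenta and velocities *)

Section momentum.
Context {R : realType} {X : ptopologicalType} {n k : nat}.
Local Notation bX := (borel X).
Context (La1 : 'M[R]_k) (La2 : 'M[R]_n).
Hypothesis La1_sym : La1^T = La1.
Hypothesis La2_sym : La2^T = La2.
Hypothesis La2_unit : La2 \in unitmx.
Context (K : set bX) (mK : measurable K).
Context (G : mxmeas R X n n) (q : mxmeas R X n k) (r : mxmeas R X n n).
Context (A : bX -> 'M[R]_n).
Hypothesis Apsd : forall x, psdmx (A x).
Hypothesis mA : mx_measurable K A.
Local Notation mu := (ref1 G).
Local Notation la := (ref3 G q r).
Local Notation sc := (scaled_field (T := bX) La1 La2).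

(* In the paper's notation q = G u and R = G W for v = (u, W), except that u is
   first projected onto the range of La1; h is the density of the reference
   measure of G with respect to the one of (G, q, R). *)
Definition momentum_of (h : bX -> R) (v : bX -> 'M[R]_(n, k) * 'M[R]_n) :=
  {ae la, forall x, K x ->
    [/\ density la G x = h x *: A x,
        density la q x = density la G x *m (v x).1 *m (mpinv La1 *m La1) &
        density la r x = density la G x *m (v x).2]}.

Context (h : bX -> R) (hP : change_density mu la h).
Context (v : bX -> 'M[R]_(n, k) * 'M[R]_n).
Hypothesis mv : field_measurable K v.
Hypothesis qv : momentum_of h v.

Let mG : mx_measurable K (density la G).
Proof.
have [dG _ _] := ref3_dominates G q r.
exact: mx_density_measurable (density_mx_density dG).
Qed.

Let mq : mx_measurable K (density la q).
Proof.
have [_ dq _] := ref3_dominates G q r.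
exact: mx_density_measurable (density_mx_density dq).
Qed.

Let mr : mx_measurable K (density la r).
Proof.
have [_ _ dr] := ref3_dominates G q r.
exact: mx_density_measurable (density_mx_density dr).
Qed.

Let mh : measurable_fun K h.
Proof. by apply: measurable_funTS; exact: change_density_measurable hP. Qed.

Let mw (w : bX -> 'M[R]_(n, k) * 'M[R]_n) : field_measurable K w ->
  measurable_fun K (wdot A (sc w) (sc v)).
Proof.
move=> [w1 w2]; have [v1 v2] := mv.
by apply: measurable_wdot => //; exact: scaled_field_measurable.
Qed.

(** Passing from one reference measure to the other multiplies the weight by h and leaves the
    velocity unchanged; the kinetic energy is linear in the weight, so h comes out as the change of
    variables factor. *)
Lemma Jaction_momentum : Jaction La1 La2 K G q r =
  (2^-1%:E * \int[mu]_(x in K) (wdot A (sc v) (sc v) x)%:E)%E.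
Proof.
have [h0 _ _ cov] := hP.
rewrite cov//; last exact: mw.
rewrite -ge0_integralZl_EFin//; last 2 first.
- by move=> x _; rewrite lee_fin mulr_ge0 ?wdot_ge0.
- by apply/measurable_EFinP; apply: measurable_funM => //; exact: mw.
apply: ae_eq_integral => //.
- exact: measurable_Jdensity.
- apply/measurable_EFinP; apply: measurable_funM => //.
  by apply: measurable_funM => //; exact: mw.
- apply: filterS qv => x H Kx; have [GE -> ->] := H Kx.
  have psdG : psdmx (density la G x) by rewrite GE; exact: psdmxZ.
  rewrite (Jdensity_momentum La2 La1_sym (v x) psdG) GE pair_formZ -EFinM.
  by rewrite wdot_scaled_field -/(pair_form La1 La2 (A x) (v x) (v x)) (mulrC (h x)).
Qed.

Lemma pairing_momentum (F : bX -> 'M[R]_(n, k)) (Phi : bX -> 'M[R]_n) :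
  mx_regular K F -> mx_regular K Phi ->
  pairing K F q + pairing K Phi r =
  field_dot mu K A La1 La2
    (fun x => (F x *m (La1 *m La1), Phi x *m (La2 *m La2))) v.
Proof.
move=> FR PhiR; have [_ dq dr] := ref3_dominates G q r.
have qd := density_mx_density dq; have rd := density_mx_density dr.
rewrite (pairing_density mK FR qd) (pairing_density mK PhiR rd).
rewrite -RintegralD//; last 2 first.
- by apply: mx_regular_mxdot_integrable => //; exact: mx_density_integrable qd.
- by apply: mx_regular_mxdot_integrable => //; exact: mx_density_integrable rd.
have [h0 _ _ cov] := hP.
set w := fun x => (F x *m (La1 *m La1), Phi x *m (La2 *m La2)); have mwv : field_measurable K w.
  have [mF _] := mx_regular_mulr (La1 *m La1) FR.
  by have [mPhi _] := mx_regular_mulr (La2 *m La2) PhiR.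
rewrite /field_dot /Rintegral cov//; last exact: mw.
congr fine; apply: ae_eq_integral => //.
- apply/measurable_EFinP/measurable_funD; apply: measurable_mxdot => //.
    exact: FR.1.
  exact: PhiR.1.
- by apply/measurable_EFinP; apply: measurable_funM => //; exact: mw.
- apply: filterS qv => x H Kx; have [GE -> ->] := H Kx.
  rewrite wdot_scaled_field -/(pair_form La1 La2 (A x) (w x) (v x)) mulrC.
  by rewrite -pair_formZ -GE pair_form_Pi.
Qed.

End momentum.

(** * Velocities of competitors of finite action *)

Section velocity_fields.
Context {R : realType} {X : ptopologicalType} {n k : nat}.
Local Notation bX := (borel X).
Context (La1 : 'M[R]_k) (La2 : 'M[R]_n).
Hypothesis La1_sym : La1^T = La1.
Context (K : set bX) (mK : measurable K).
Context (G : mxmeas R X n n) (q : mxmeas R X n k) (r : mxmeas R X n n).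
Hypothesis fin : (Jaction La1 La2 K G q r < +oo)%E.
Local Notation mu := (ref1 G).
Local Notation la := (ref3 G q r).
Local Notation vel := (fun x : bX =>
  (mpinv (density la G x) *m density la q x,
   mpinv (density la G x) *m density la r x)).

Let dG : mx_density la G (density la G).
Proof. by have [? _ _] := ref3_dominates G q r; exact: density_mx_density. Qed.

Let dq : mx_density la q (density la q).
Proof. by have [_ ? _] := ref3_dominates G q r; exact: density_mx_density. Qed.

Let dr : mx_density la r (density la r).
Proof. by have [_ _ ?] := ref3_dominates G q r; exact: density_mx_density. Qed.

Let ok_ae : {ae la, forall x, K x ->
  action_ok La1 (density la G x) (density la q x) (density la r x)}.
Proof.
by apply: (action_ok_ae mK La1_sym) fin;
  [exact: mx_density_measurable dG|exact: mx_density_measurable dq|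
   exact: mx_density_measurable dr].
Qed.

Lemma density_ref3_ref1 (h : bX -> R) : change_density mu la h ->
  {ae la, forall x, density la G x = h x *: density mu G x}.
Proof.
by move=> hP; exact: mx_density_ae dG (mx_density_change hP (ref1_density G)).
Qed.

(** Finite action makes the density of G positive semidefinite almost everywhere for [ref3 G q r];
    dividing by h carries this to [ref1 G]. On the exceptional set and off K the weight is put to
    0. *)
Lemma weight_exists : exists A : bX -> 'M[R]_n,
  [/\ forall x, psdmx (A x), mx_measurable K A,
      forall i j, mu.-integrable K (fun x => (A x i j)%:E) &
      {ae mu, forall x, K x -> density mu G x = A x}].
Proof.
have mula : mu `<< la by exact: ref1_ref3_dominates.
have [h hP] := change_density_exists mula; have [h0 _ _ _] := hP.
have psd_ae : {ae mu, forall x, K x -> psdmx (density mu G x)}.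
  apply: filterS3 (dominates_ae mula ok_ae) (change_density_neq0 hP)
    (dominates_ae mula (density_ref3_ref1 hP)) => x H hx0 GE Kx.
  have [+ _ _ _] := H Kx; rewrite GE => psdhG.
  rewrite -[density _ _ _](scalerK hx0); apply: psdmxZ => //.
  by rewrite invr_ge0.
have [N [mN N0 NP]] := psd_ae.
pose A x := \1_(K `\` N) x *: density mu G x.
have mKN : measurable (K `\` N) by exact: measurableD.
exists A; split.
- move=> x; rewrite /A indicE; have [|] := boolP (x \in K `\` N).
    rewrite inE scale1r => -[Kx Nx].
    by apply: contrapT => npsd; apply: Nx; apply: NP => /(_ Kx).
  by rewrite scale0r => _; exact: psdmx0.
- apply: mx_measurableZ; first exact: measurable_indic.
  exact: mx_density_measurable (ref1_density G).
- move=> i j; rewrite /A; under eq_fun do rewrite mxE.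
  apply: integrable_mul_bounded => //.
    by exists 1 => x _; rewrite indicE; case: (_ \in _); rewrite ?normr1 ?normr0.
  exact: mx_density_integrable (ref1_density G) _ _.
- exists N; split => // x /= nH; apply: contrapT => Nx; apply: nH => Kx.
  by rewrite /A indicE mem_set ?scale1r.
Qed.

Lemma velocity_measurable : field_measurable K vel.
Proof.
have mi : mx_measurable K (fun x => mpinv (density la G x)).
  by apply: mx_measurable_mpinv; exact: mx_density_measurable dG.
split; apply: mx_measurable_mul => //.
  exact: mx_density_measurable dq.
exact: mx_density_measurable dr.
Qed.

Lemma velocity_momentum (A : bX -> 'M[R]_n) (h : bX -> R) : change_density mu la h ->
  {ae mu, forall x, K x -> density mu G x = A x} ->
  momentum_of La1 K G q r A h vel.
Proof.
move=> hP aeA.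
apply: filterS3 ok_ae (change_density_ae hP aeA) (density_ref3_ref1 hP).
(* Where h = 0 the density of G is 0 too, so it equals [h x *: A x] whatever A x is. *)
move=> x H [hx0|GA] GE Kx; have [_ qLa Xq Xr] := H Kx.
  split; first by rewrite GE hx0 !scale0r.
    by rewrite /= (mulmxA (density la G x)) Xq qLa.
  by rewrite /= (mulmxA (density la G x)) Xr.
split; first by rewrite GE GA.
  by rewrite /= (mulmxA (density la G x)) Xq qLa.
by rewrite /= (mulmxA (density la G x)) Xr.
Qed.

End velocity_fields.

(** * The transport problem *)

Section transport_problem.
Context {R : realType} {n k d : nat}.
Context (La1 : 'M[R]_k) (La2 : 'M[R]_n).
Hypothesis La1_sym : La1^T = La1.
Hypothesis La2_sym : La2^T = La2.
Hypothesis La2_unit : La2 \in unitmx.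
Context (Omega : set 'rV[R]_d) (Omega_compact : compact Omega).
Context (D : diffop R d n k) (G0 G1 : mxmeas R 'rV[R]_d n n).
Local Notation X := (R * 'rV[R]_d)%type.
Local Notation bX := (borel X).
Local Notation Q := (spacetime Omega : set bX).
Local Notation field := (bX -> 'M[R]_(n, k) * 'M[R]_n)%type.

Let mQ : measurable Q.
Proof. by apply: borel_closed; exact: spacetime_closed. Qed.

Lemma C1fun_regular (Phi : C1fun n (spacetime Omega)) : mx_regular Q Phi.
Proof.
apply: continuous_within_regular; [exact: spacetime_compact|exact: spacetime_closed|].
exact: C1_cont.
Qed.

Lemma diffop_regular (Phi : C1fun n (spacetime Omega)) :
  mx_regular Q (diffop_app D Phi).
Proof.
apply: mx_regularD; first exact: mx_regular_linear (C1fun_regular Phi).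
apply: mx_regular_sum => j; apply: mx_regular_linear.
apply: continuous_within_regular; [exact: spacetime_compact|exact: spacetime_closed|].
exact: C1dx_cont.
Qed.

Lemma CE_lform G q r : CE Omega D G0 G1 G q r -> forall Phi : C1fun n (spacetime Omega),
  lform G0 G1 G Phi = pairing Q (diffop_app D Phi) q + pairing Q Phi r.
Proof. by move=> [_ _ _ ce] Phi; rewrite /lform -ce; ring. Qed.

Section fixed_weight.
Context (G : mxmeas R X n n) (A : bX -> 'M[R]_n).
Hypothesis Apsd : forall x, psdmx (A x).
Hypothesis mA : mx_measurable Q A.
Hypothesis iA : forall i j, (ref1 G).-integrable Q (fun x => (A x i j)%:E).
Hypothesis aeA : {ae ref1 G, forall x, Q x -> density (ref1 G) G x = A x}.

Local Notation L := (L2mem La1 La2 Q G).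
Local Notation fmem := (field_mem (ref1 G) Q A La1 La2).
Local Notation b := (field_dot (ref1 G) Q A La1 La2).

Let LP v : L v <-> fmem v.
Proof. exact: L2memP. Qed.

Let LE v w : L v -> L w -> L2ip La1 La2 Q G v w = (b v w)%:E.
Proof. exact: L2ipE. Qed.

Let L_lin c (u v : field) : L u -> L v -> L (u + c *: v).
Proof. by move=> /LP Lu /LP Lv; apply/LP; exact: field_mem_lin. Qed.

Let b_sym u v : L u -> L v -> b u v = b v u.
Proof. by move=> /LP Lu /LP Lv; exact: field_dot_sym. Qed.

Let b_lin c (u v w : field) : L u -> L v -> L w -> b (u + c *: v) w = b u w + c * b v w.
Proof. by move=> /LP Lu /LP Lv /LP Lw; exact: field_dot_lin. Qed.

Let b_ge0 u : L u -> 0 <= b u u.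
Proof. by move=> /LP Lu; exact: field_dot_ge0. Qed.

Let L_complete (u : nat -> field) : (forall m, L (u m)) ->
  (forall m j, (m <= j)%N -> b (u m - u j) (u m - u j) <= 16%:R^-1 ^+ m) ->
  exists2 v, L v & forall m, b (v - u m) (v - u m) <= 16%:R^-1 ^+ m.
Proof.
move=> Lu cauchy.
have [|v Lv vu] := field_complete mQ Apsd mA La2_unit _ cauchy.
  by move=> m; exact/LP.
by exists v => //; exact/LP.
Qed.

Lemma PiD_mem (Phi : C1fun n (spacetime Omega)) : L (PiD La1 La2 D Phi).
Proof.
have FR := mx_regular_mulr (La1 *m La1) (diffop_regular Phi).
have PR := mx_regular_mulr (La2 *m La2) (C1fun_regular Phi).
apply/LP; split; [exact: FR.1|exact: PR.1|].
apply: wdot_regular_integrable => //; split.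
  by apply: scaled_field_measurable; [exact: FR.1|exact: PR.1].
have [_ [M1 M1P]] := mx_regular_mulr (mpinv La1) FR.
have [_ [M2 M2P]] := mx_regular_mulr (invmx La2) PR.
exists (`|M1| + `|M2|) => x i j Qx; rewrite mxE.
case: (fintype.split j) => l.
  by rewrite (le_trans (M1P x i l Qx))// (le_trans (ler_norm _))// lerDl.
by rewrite (le_trans (M2P x i l Qx))// (le_trans (ler_norm _))// lerDr.
Qed.

Lemma PiD_lin (c : R) (Phi Psi : C1fun n (spacetime Omega)) :
  exists Xi : C1fun n (spacetime Omega), PiD La1 La2 D Xi =
    (PiD La1 La2 D Phi : field) + c *: (PiD La1 La2 D Psi : field).
Proof.
have [Xi [XiE _ XidxE]] := C1fun_lin c Phi Psi.
exists Xi; apply/funext => z; rewrite /PiD /diffop_app.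
apply/pair_equal_spec; split; rewrite /= XiE; last first.
  by rewrite mulmxDl -scalemxAl.
rewrite linearD linearZ /= scalemxAl -mulmxDl; congr (_ *m _).
under eq_bigr do rewrite XidxE linearD linearZ /=.
by rewrite big_split /= -scaler_sumr scalerDr addrACA.
Qed.

Lemma velocity_feasible q r : CEoo La1 La2 Omega D G0 G1 G q r ->
  feasible La1 La2 Omega D G0 G1 G (velocity G q r) /\
  Jaction La1 La2 Q G q r = (2^-1%:E * L2norm2 La1 La2 Q G (velocity G q r))%E.
Proof.
move=> [ce fin].
have mula : ref1 G `<< ref3 G q r by exact: ref1_ref3_dominates.
have [h hP] := change_density_exists mula.
have mv : field_measurable Q (velocity G q r) by exact: velocity_measurable.
have vq := velocity_momentum La1_sym mQ fin hP aeA.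
have JE := Jaction_momentum La2 La1_sym mQ Apsd mA hP mv vq.
have NE : L2norm2 La1 La2 Q G (velocity G q r) = _ := L2norm2E mQ Apsd mA aeA La1 La2 mv.
have JN : Jaction La1 La2 Q G q r = (2^-1%:E * L2norm2 La1 La2 Q G (velocity G q r))%E.
  by rewrite NE; exact: JE.
have Lv : L (velocity G q r).
  split; [exact: mv.1|exact: mv.2|].
  move: fin; rewrite JN; case: (L2norm2 _ _ _ _ _) => [x _| |]; [by rewrite ltry| |by []].
  by rewrite gt0_muley// lte_fin.
split=> //; split=> // Phi.
rewrite (LE (PiD_mem Phi) Lv).
rewrite (CE_lform ce) (pairing_momentum La1_sym La2_sym La2_unit mQ mA hP mv vq)//.
  exact: diffop_regular.
exact: C1fun_regular.
Qed.

Lemma feasible_realized v : concentrated (spacetime Omega) G -> sym_valued G ->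
  feasible La1 La2 Omega D G0 G1 G v ->
  exists q r, CEoo La1 La2 Omega D G0 G1 G q r /\
    Jaction La1 La2 Q G q r = (2^-1%:E * L2norm2 La1 La2 Q G v)%E.
Proof.
move=> Gon Gsym [Lv vfeas].
have fv : fmem v by exact/LP.
have mv : field_measurable Q v by have [] := Lv.
(* The indicator keeps the momenta concentrated on Q, and La1^+ La1 puts the rows of the first one
   in the range of La1. *)
pose gq x : 'M[R]_(n, k) := \1_Q x *: (A x *m (v x).1 *m (mpinv La1 *m La1)).
pose gr x : 'M[R]_n := \1_Q x *: (A x *m (v x).2).
have restr m p (F : bX -> 'M[R]_(m, p)) :
    (forall i j, (ref1 G).-integrable Q (fun x => (F x i j)%:E)) ->
    forall i j, (ref1 G).-integrable setT (EFin \o (fun x => (\1_Q x *: F x) i j)).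
  move=> iF i j; have /(integrable_mkcond _ mQ) := iF i j.
  congr integrable; apply/funext => x; rewrite patchE /= mxE indicE.
  by case: (_ \in _); rewrite ?mul1r ?mul0r.
have [mS iS] := scaled_field_sq_integrable fv.
have iAS := sq_integrable_weight mQ Apsd mA iA (conj mS iS).
(* Off the indicator, both momenta are A times the scaled field times a constant matrix, and A V is
   integrable for square integrable V. *)
have iq i j : (ref1 G).-integrable setT (EFin \o (fun x => gq x i j)).
  apply: restr => {}i {}j.
  have -> : (fun x => ((A x *m (v x).1 *m (mpinv La1 *m La1)) i j)%:E) =
      (fun x => ((A x *m scaled_field (T := bX) La1 La2 v x *m col_mx La1 0) i j)%:E).
    apply/funext => x; rewrite /scaled_field -[in RHS]mulmxA mul_row_col mulmx0 addr0.
    by rewrite !mulmxA.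
  exact: mx_integrable_mulr.
have ir i j : (ref1 G).-integrable setT (EFin \o (fun x => gr x i j)).
  apply: restr => {}i {}j.
  have -> : (fun x => ((A x *m (v x).2) i j)%:E) =
      (fun x => ((A x *m scaled_field (T := bX) La1 La2 v x *m col_mx 0 La2) i j)%:E).
    apply/funext => x; rewrite /scaled_field -[in RHS]mulmxA mul_row_col mulmx0 add0r.
    by rewrite -[in RHS]mulmxA mulVmx// mulmx1.
  exact: mx_integrable_mulr.
have /choice[q qE] : forall i, exists qi : 'I_k -> {charge set bX -> \bar R},
    forall j, has_density (qi j) (ref1 G) (fun x => gq x i j).
  move=> i; have /choice[f fP] : forall j, exists nu : {charge set bX -> \bar R},
      has_density nu (ref1 G) (fun x => gq x i j).
    by move=> j; exact: charge_of_integrable.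
  by exists f.
have /choice[r rE] : forall i, exists ri : 'I_n -> {charge set bX -> \bar R},
    forall j, has_density (ri j) (ref1 G) (fun x => gr x i j).
  move=> i; have /choice[f fP] : forall j, exists nu : {charge set bX -> \bar R},
      has_density nu (ref1 G) (fun x => gr x i j).
    by move=> j; exact: charge_of_integrable.
  by exists f.
have conc m p (M : mxmeas R X m p) (F : bX -> 'M[R]_(m, p)) :
    mx_density (ref1 G) M (fun x => \1_Q x *: F x) -> concentrated (spacetime Omega) M.
  move=> MF B mB BQ; apply/matrixP => i j; rewrite !mxE.
  have [_ ->//] := MF i j; rewrite integral0_eq// => x Bx.
  rewrite mxE indicE memNset ?mul0r// => Qx.
  by have : (B `&` spacetime Omega) x by []; rewrite BQ.
have mula : ref1 G `<< ref3 G q r by exact: ref1_ref3_dominates.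
have [h hP] := change_density_exists mula.
(* The momenta are built over [ref1 G] but their action is taken over [ref3 G q r]; h relates the
   two densities of each. *)
have vq : momentum_of La1 Q G q r A h v.
  have [dG dq dr] := ref3_dominates G q r.
  have q3 := mx_density_ae (density_mx_density dq) (mx_density_change hP qE).
  have r3 := mx_density_ae (density_mx_density dr) (mx_density_change hP rE).
  have G3 := density_ref3_ref1 hP.
  have aeF : Filter (nbhs (almost_everywhere (ref3 G q r))).
    exact: ae_filter_ringOfSetsType.
  have qr3 : {ae ref3 G q r, forall x, density (ref3 G q r) q x = h x *: gq x /\
      density (ref3 G q r) r x = h x *: gr x} by apply: filterS2 q3 r3.
  apply: filterS3 qr3 G3 (change_density_ae hP aeA) => x [qx rx] Gx GA Qx.
  have GhA : density (ref3 G q r) G x = h x *: A x.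
    by rewrite Gx; case: GA => [->|/(_ Qx) ->//]; rewrite !scale0r.
  split=> //; rewrite GhA ?qx ?rx /gq /gr indicE mem_set// scale1r.
    by rewrite -!scalemxAl.
  by rewrite -scalemxAl.
have JE : Jaction La1 La2 Q G q r = (2^-1%:E * L2norm2 La1 La2 Q G v)%E.
  rewrite (L2norm2E mQ Apsd mA aeA La1 La2 mv).
  by rewrite (Jaction_momentum La2 La1_sym mQ Apsd mA hP mv vq).
exists q, r; split=> //; split; last first.
  by rewrite JE /L2norm2 (LE Lv Lv) -EFinM ltry.
split; [by []|exact: (conc _ _ q _ qE)|exact: (conc _ _ r _ rE)|] => Phi.
have [bl] := etrans (esym (LE (PiD_mem Phi) Lv)) (vfeas Phi).
have pE : pairing Q (diffop_app D Phi) q + pairing Q Phi r = lform G0 G1 G Phi.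
  rewrite -bl (pairing_momentum La1_sym La2_sym La2_unit mQ mA hP mv vq)//.
    exact: diffop_regular.
  exact: C1fun_regular.
by rewrite -addrA pE /lform; ring.
Qed.

Let P (Phi : C1fun n (spacetime Omega)) : field := PiD La1 La2 D Phi.
Local Notation ell := (lform G0 G1 G).

Let LPi Phi : L (P Phi) := PiD_mem Phi.

Let LB (u v : field) : L u -> L v -> L (u - v).
Proof. exact: form_memB. Qed.

Lemma L2norm2_dot (v : field) : L v -> L2norm2 La1 La2 Q G v = (b v v)%:E.
Proof. by move=> Lv; exact: (LE Lv Lv). Qed.

Lemma L2norm_dist (u v : field) : L u -> L v ->
  L2norm La1 La2 Q G (subf u v) = (form_dist b u v)%:E.
Proof.
move=> Lu Lv; have Luv := LB Lu Lv.
by rewrite /L2norm; have -> := L2norm2_dot Luv.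
Qed.

Lemma HspaceP v : Hspace La1 La2 Omega D G v <-> span_closure L b P v.
Proof.
split=> -[Lv clv]; split=> // e e0; have [Phi vPhi] := clv e e0; exists Phi.
  by rewrite -lte_fin -(L2norm_dist Lv (LPi Phi)).
by rewrite (L2norm_dist Lv (LPi Phi)) lte_fin.
Qed.

Lemma continuous_extensionP l :
  continuous_extension La1 La2 Omega D G0 G1 G l <-> extends L b P ell l.
Proof.
split=> -[lE lc]; split=> // v Hv e e0.
  have /HspaceP Hv' := Hv; have [dl dl0 dlP] := lc _ Hv' _ e0.
  exists dl => // w Hw wv; have /HspaceP Hw' := Hw; apply: dlP => //.
  have [Lv _] := Hv; have [Lw _] := Hw.
  by rewrite (L2norm_dist Lw Lv) lte_fin.
have /HspaceP Hv' := Hv; have [dl dl0 dlP] := lc _ Hv' _ e0.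
exists dl => // w Hw wv; have /HspaceP Hw' := Hw; apply: dlP => //.
have [Lv _] := Hv; have [Lw _] := Hw.
by rewrite -lte_fin -(L2norm_dist Lw Lv).
Qed.

Lemma riesz_repP l v : riesz_rep La1 La2 Omega D G l v <-> represents L b P l v.
Proof.
split=> -[Hv vE].
  have Hv' : span_closure L b P v by exact/HspaceP.
  split=> // w Hw; have [Lv _] := Hv'; have [Lw _] := Hw.
  by have /HspaceP Hw' := Hw; have := vE _ Hw'; rewrite (LE Lw Lv) => -[].
have Hv' : Hspace La1 La2 Omega D G v by exact/HspaceP.
split=> // w Hw; have [Lv _] := Hv'; have [Lw _] := Hw.
by have /HspaceP Hw' := Hw; rewrite (LE Lw Lv) (vE _ Hw').
Qed.

Lemma feasibleP v : feasible La1 La2 Omega D G0 G1 G v <-> solves L b P ell v.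
Proof.
split=> -[Lv vE]; split=> // Phi; have := vE Phi.
  by rewrite (LE (LPi Phi) Lv) => -[].
by rewrite (LE (LPi Phi) Lv) => <-.
Qed.

Section riesz.
Context (l : field -> R) (v : field).
Hypothesis lE : forall Phi, l (P Phi) = ell Phi.
Hypothesis v_repr : riesz_rep La1 La2 Omega D G l v.

Let vR : represents L b P l v. Proof. exact/riesz_repP. Qed.
Let vS : solves L b P ell v.
Proof. exact: (represents_solves L_lin b_sym b_lin LPi lE vR). Qed.
Let Lv : L v. Proof. by case: vS. Qed.

Lemma riesz_min_norm : min_norm_solution La1 La2 Omega D G0 G1 G v.
Proof.
have vF : feasible La1 La2 Omega D G0 G1 G v by exact/feasibleP.
split=> //; apply/le_anti/andP; split.
  apply: le_ereal_inf_tmp => _ [w fw <-]; have /feasibleP wS := fw; have [Lw _] := wS.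
  have := solves_pythagoras L_lin b_sym b_lin b_ge0 LPi lE vR wS.
  rewrite [X in (_ * X <= _)%E](L2norm2_dot Lv) [X in (_ <= _ * X)%E](L2norm2_dot Lw).
  rewrite -!EFinM lee_fin => ->.
  by rewrite ler_pM2l// lerDl; apply: b_ge0; exact: LB.
by apply: ereal_inf_lbound; exists v.
Qed.

Lemma min_norm_unique w : min_norm_solution La1 La2 Omega D G0 G1 G w ->
  L2norm La1 La2 Q G (subf w v) = 0%E.
Proof.
move=> [fw minw]; have [_ minv] := riesz_min_norm.
have /feasibleP wS := fw; have [Lw _] := wS.
have := etrans minw (esym minv).
rewrite [X in (_ * X = _)%E](L2norm2_dot Lw) [X in (_ = _ * X)%E](L2norm2_dot Lv).
rewrite -!EFinM => -[] half.
have := solves_pythagoras L_lin b_sym b_lin b_ge0 LPi lE vR wS.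
rewrite (L2norm_dist Lw Lv) /form_dist.
move: half; move: (b _ _) (b v v) (b (w - v) _) => x y z xy xyz.
by have -> : z = 0 by [lra]; rewrite sqrtr0.
Qed.

Lemma Jcost_riesz : concentrated (spacetime Omega) G -> sym_valued G ->
  Jcost La1 La2 Omega D G0 G1 G = (2^-1%:E * L2norm2 La1 La2 Q G v)%E.
Proof.
have [vF minv] := riesz_min_norm.
move=> Gon Gsym; apply/le_anti/andP; split.
  have [q [r [ce JE]]] := feasible_realized Gon Gsym vF.
  apply: ereal_inf_lbound; exists q, r; split; first exact: ce.
  (* The velocity of the realized momenta need not be v itself; the two norms agree because both
     give the action. *)
  by have [_ <-] := velocity_feasible ce; exact: esym JE.
rewrite minv.
apply: le_ereal_inf_tmp => _ [q [r [ce ->]]]; apply: ereal_inf_lbound.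
by exists (velocity G q r); [have [] := velocity_feasible ce|exact: erefl].
Qed.

Lemma Jdual_riesz : Jdual La1 La2 Omega D G0 G1 G = (2^-1%:E * L2norm2 La1 La2 Q G v)%E.
Proof.
have elt Phi : ((ell Phi)%:E - 2^-1%:E * L2norm2 La1 La2 Q G (PiD La1 La2 D Phi))%E =
    (2^-1 * b v v - 2^-1 * form_dist b v (P Phi) ^+ 2)%:E.
  have -> := L2norm2_dot (LPi Phi); rewrite -EFinM -EFinB; congr EFin.
  exact: (dual_gap L_lin b_sym b_lin b_ge0 LPi lE vR).
rewrite (L2norm2_dot Lv) -EFinM; apply/le_anti/andP; split.
  apply: ge_ereal_sup => _ [Phi _ <-]; rewrite elt lee_fin gerBl mulr_ge0//.
  exact: sqr_ge0.
apply/lee_addgt0Pr => e e0.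
have [[_ clv] _] := vR.
(* A distance t below both e and 1 satisfies t^2 / 2 <= e. *)
have e1 : 0 < Num.min e 1 by rewrite lt_min e0 ltr01.
have [Phi] := clv _ e1; rewrite lt_min => /andP[vPhi vPhi1].
apply: (@le_trans _ _ (((ell Phi)%:E -
    2^-1%:E * L2norm2 La1 La2 Q G (PiD La1 La2 D Phi)) + e%:E)%E).
  rewrite elt -EFinD lee_fin.
  have dist0 : 0 <= form_dist b v (P Phi) by exact: sqrtr_ge0.
  by move: (form_dist _ _ _) vPhi vPhi1 dist0 => t te t1 t0; nra.
by rewrite leeD2r//; apply: ereal_sup_ubound; exists Phi.
Qed.

End riesz.

(** Pairing with any feasible field is the extension, so the continuity of [lform] comes from
    Cauchy-Schwarz against that field. *)
Lemma riesz_extension v0 : feasible La1 La2 Omega D G0 G1 G v0 ->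
  exists l, [/\ continuous_extension La1 La2 Omega D G0 G1 G l,
    forall l', continuous_extension La1 La2 Omega D G0 G1 G l' ->
      forall v, Hspace La1 La2 Omega D G v -> l' v = l v &
    exists v, riesz_rep La1 La2 Omega D G l v].
Proof.
move=> /feasibleP v0S; exists (b ^~ v0); split.
- apply/continuous_extensionP.
  exact: (extends_dot L_lin b_sym b_lin b_ge0 v0S).
- move=> l' /continuous_extensionP l'E v /HspaceP Hv.
  exact: (extends_unique L_lin b_sym b_lin b_ge0 LPi v0S l'E Hv).
- have [Phi0 _] := @C1fun_exists R d n (spacetime Omega).
  have [v vR] := represents_exists L_lin b_sym b_lin b_ge0 L_complete Phi0 LPi PiD_lin v0S.
  by exists v; apply/riesz_repP.
Qed.

End fixed_weight.

Lemma WB2_Jcost : WB2 La1 La2 Omega D G0 G1 =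
  ereal_inf [set Jcost La1 La2 Omega D G0 G1 G | G in ACset La1 La2 Omega D G0 G1].
Proof.
have JE G q r : CEoo La1 La2 Omega D G0 G1 G q r ->
    Jaction La1 La2 Q G q r = (2^-1%:E * L2norm2 La1 La2 Q G (velocity G q r))%E.
  move=> ce; have [_ fin] := ce.
  have [A [Apsd mA iA aeA]] := weight_exists La1_sym mQ fin.
  by have [] := velocity_feasible Apsd mA iA aeA ce.
apply/le_anti/andP; split.
  apply: le_ereal_inf_tmp => _ [G GAC <-].
  apply: le_ereal_inf_tmp => _ [q [r [ce ->]]].
  rewrite -JE//; apply: ereal_inf_lbound; exists G, q, r; split=> //.
  by case: ce.
apply: le_ereal_inf_tmp => _ [G [q [r [ce ->]]]].
(* An infinite action is above any infimum; a finite one makes (q, r) a competitor in the cost of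
   its own G. *)
have [fin|] := boolP (Jaction La1 La2 Q G q r < +oo)%E; last first.
  by rewrite -leNgt leye_eq => /eqP ->; rewrite leey.
have ceoo : CEoo La1 La2 Omega D G0 G1 G q r by [].
apply: (@le_trans _ _ (Jcost La1 La2 Omega D G0 G1 G)).
  by apply: ereal_inf_lbound; exists G => //; exists q, r.
rewrite JE//; apply: ereal_inf_lbound; exists q, r; split=> //.
Qed.

End transport_problem.

Lemma pdmx_unit (R : realType) n (A : 'M[R]_n) : pdmx A -> A \in unitmx.
Proof.
move=> [symA posA]; rewrite -row_free_unit -kermx_eq0; apply/eqP/row_matrixP => i.
rewrite row0; set x := row i _; apply/eqP/contraT => x0.
have xA : x *m A = 0 by apply/sub_kermxP; exact: row_sub.
have /posA : x^T != 0 by rewrite trmx_eq0.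
by rewrite trmxK xA mul0mx mxE ltxx.
Qed.

Theorem theorem4p5 (R : realType) (n k d : nat)
    (n_gt0 : (0 < n)%N) (k_gt0 : (0 < k)%N) (d_gt0 : (0 < d)%N)
    (La1 : 'M[R]_k) (La2 : 'M[R]_n) (La1_psd : psdmx La1) (La2_pd : pdmx La2)
    (Omega : set 'rV[R]_d) (Omega_compact : compact Omega)
    (Omega_int : interior Omega !=set0) (Omega_smooth : smooth_boundary Omega)
    (D : diffop R d n k) (D_I : op0 D 1%:M = 0)
    (G0 G1 : mxmeas R 'rV[R]_d n n)
    (G0_on : concentrated Omega G0) (G1_on : concentrated Omega G1)
    (G0_psd : psd_valued G0) (G1_psd : psd_valued G1) :
  WB2 La1 La2 Omega D G0 G1 =
    ereal_inf [set Jcost La1 La2 Omega D G0 G1 G | G in ACset La1 La2 Omega D G0 G1] /\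
  forall G, ACset La1 La2 Omega D G0 G1 G ->
    (exists l, [/\ continuous_extension La1 La2 Omega D G0 G1 G l,
        forall l', continuous_extension La1 La2 Omega D G0 G1 G l' ->
          forall v, Hspace La1 La2 Omega D G v -> l' v = l v,
        exists v, riesz_rep La1 La2 Omega D G l v &
        forall v, riesz_rep La1 La2 Omega D G l v ->
          [/\ Jcost La1 La2 Omega D G0 G1 G =
                (2^-1%:E * L2norm2 La1 La2 (spacetime Omega) G v)%E,
              min_norm_solution La1 La2 Omega D G0 G1 G v &
              forall w, min_norm_solution La1 La2 Omega D G0 G1 G w ->
                L2norm La1 La2 (spacetime Omega) G (subf w v) = 0%E]]) /\
    Jcost La1 La2 Omega D G0 G1 G = Jdual La1 La2 Omega D G0 G1 G.
Proof.
have [La1_sym _] := La1_psd; have [La2_sym _] := La2_pd.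
have La2_unit := pdmx_unit La2_pd.
split; first exact: WB2_Jcost.
(* The competitor behind [ACset] serves twice: its finite action yields the weight A, and its
   velocity is the feasible field from which the extension is built. *)
move=> G [q [r ce]]; have [[[Gon Gsym] _ _ _] fin] := ce.
have mQ : measurable (spacetime Omega : set (borel (R * 'rV[R]_d)%type)).
  by apply: borel_closed; exact: spacetime_closed.
have [A [Apsd mA iA aeA]] := weight_exists La1_sym mQ fin.
have [v0F _] := velocity_feasible La1_sym La2_sym La2_unit Omega_compact Apsd mA iA aeA ce.
have [l [lext luniq [v vR]]] :=
  riesz_extension La2_unit Omega_compact Apsd mA iA aeA v0F.
have [lE _] := lext.
have Jcost_v w (wR : riesz_rep La1 La2 Omega D G l w) := Jcost_riesz La1_sym La2_sym
  La2_unit Omega_compact Apsd mA iA aeA lE wR Gon Gsym.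
split; last first.
  rewrite (Jcost_v _ vR).
  by rewrite (Jdual_riesz Omega_compact Apsd mA iA aeA lE vR).
exists l; split=> //; first by exists v.
move=> w wR; split; first exact: Jcost_v.
  exact: (riesz_min_norm Omega_compact Apsd mA iA aeA lE wR).
move=> w'; exact: (min_norm_unique Omega_compact Apsd mA iA aeA lE wR).
Qed.
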